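(* Let $\mathbf{X}=(X_1,\ldots,X_N)^T$ be a vector of $N\in\mathbb{N}$ input random variables fulfilling Assumption 1 (stated in the context). For $l\in\mathbb{N}_0$, let $\mathbf{\Psi}_l(\mathbf{x})\in\mathbb{R}^{K_{N,l}}$ be the vector of multivariate orthonormal polynomials of degree $l$ consistent with the probability measure $f_{\mathbf{X}}(\mathbf{x})d\mathbf{x}$. Then: (1) For any random variable $y(\mathbf{X})\in L^2(\Omega,\mathcal{F},\mathbb{P})$ there exists a Fourier series in multivariate orthonormal polynomials in $\mathbf{X}$, referred to as the generalized PCE (polynomial chaos expansion) of $$y(\mathbf{X})=\sum_{l\in\mathbb{N}_0}\mathbf{C}_l^T\mathbf{\Psi}_l(\mathbf{X}),$$ where the vector of expansion coefficients $\mathbf{C}_l\in\mathbb{R}^{K_{N,l}}$ is defined by $$\mathbf{C}_l:=\mathbb{E}[y(\mathbf{X})\mathbf{\Psi}_l(\mathbf{X})]:=\int_{\mathbb{A}^N}y(\mathbf{x})\mathbf{\Psi}_l(\mathbf{x})f_{\mathbf{X}}(\mathbf{x})d\mathbf{x},\quad l\in\mathbb{N}_0.$$ (2) The generalized PCE of $y(\mathbf{X})\in L^2(\Omega,\mathcal{F},\mathbb{P})$ converges to $y(\mathbf{X})$ in mean-square, that is, for $y_m(\mathbf{X}):=\sum_{l=0}^m\mathbf{C}_l^T\mathbf{\Psi}_l(\mathbf{X})$, $m\in\mathbb{N}_0$, $$\lim_{m\to\infty}\mathbb{E}\left[|y_m(\mathbf{X})-y(\mathbf{X})|^2\right]=0;$$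 converges in probability, that is, for any $\epsilon>0$, $$\lim_{m\to\infty}\mathbb{P}\left(|y_m(\mathbf{X})-y(\mathbf{X})|>\epsilon\right)=0;$$ and converges in distribution, that is, for any $\xi\in\mathbb{R}$, $$\lim_{m\to\infty}F_m(\xi)=F(\xi)$$ such that $F_m(\xi):=\mathbb{P}(y_m(\mathbf{X})\le\xi)$ and $F(\xi):=\mathbb{P}(y(\mathbf{X})\le\xi)$ are continuous distribution functions.
   Context: $\mathbb{N}=\{1,2,\ldots\}$ and $\mathbb{N}_0=\{0,1,2,\ldots\}$. $(\Omega,\mathcal{F},\mathbb{P})$ is a complete probability space, $\mathbb{A}^N\subseteq\mathbb{R}^N$ is a bounded or unbounded subdomain, $\mathcal{B}^N$ is its Borel $\sigma$-algebra, and $\mathbb{E}$ is expectation with respect to $\mathbb{P}$. Here $y$ is a real-valued function on $\mathbb{A}^N$, $y(\mathbf{X})$ is a random variable on $(\Omega,\mathcal{F},\mathbb{P})$, and $y(\mathbf{X})\in L^2(\Omega,\mathcal{F},\mathbb{P})$ means $\mathbb{E}[y^2(\mathbf{X})]<\infty$. Assumption 1. The random vector $\mathbf{X}:(\Omega,\mathcal{F})\to(\mathbb{A}^N,\mathcal{B}^N)$ (1) has an absolutely continuous joint distribution function and a continuous joint probability density function $f_{\mathbf{X}}$ with bounded or unbounded support $\mathbb{A}^N\subseteq\mathbb{R}^N$; (2) has absolute finite moments of all orders, i.e. $\int_{\mathbb{A}^N}|\mathbf{x}^{\mathbf{j}}|f_{\mathbf{X}}(\mathbf{x})d\mathbf{x}<\infty$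 for all $\mathbf{j}\in\mathbb{N}_0^N$, where $\mathbf{x}^{\mathbf{j}}=x_1^{j_1}\cdots x_N^{j_N}$; (3) has a density $f_{\mathbf{X}}$ which either (a) has compact support, i.e. there is a compact subset $\mathbb{A}^N\subset\mathbb{R}^N$ with $\mathbb{P}(\mathbf{X}\in\mathbb{A}^N)=1$, or (b) is exponentially integrable, i.e. there is a real $\alpha>0$ with $\int_{\mathbb{A}^N}\exp(\alpha\|\mathbf{x}\|)f_{\mathbf{X}}(\mathbf{x})d\mathbf{x}<\infty$, where $\|\cdot\|$ is an arbitrary norm. For $\mathbf{j}=(j_1,\ldots,j_N)\in\mathbb{N}_0^N$, $|\mathbf{j}|=j_1+\cdots+j_N$; $\Pi_m^N=\mathrm{span}\{\mathbf{x}^{\mathbf{j}}:|\mathbf{j}|\le m\}$. Let $K_{N,l}=\binom{N+l-1}{l}$ be the number of multi-indices with $|\mathbf{j}|=l$, listed in a chosen monomial order as $\mathbf{j}^{(1)},\ldots,\mathbf{j}^{(K_{N,l})}$, and let $\mathbf{x}_l=(\mathbf{x}^{\mathbf{j}^{(1)}},\ldots,\mathbf{x}^{\mathbf{j}^{(K_{N,l})}})^T$. Multivariate orthogonal polynomials consistent with $f_{\mathbf{X}}(\mathbf{x})d\mathbf{x}$: a family $\{P_{\mathbf{j}}:\mathbf{j}\in\mathbb{N}_0^N\}$ with $P_{\mathbf{0}}=1$ and $P_{\mathbf{j}}\in\Pi_{|\mathbf{j}|}^N$, such that for each $l$ the column vector $\mathbf{P}_l(\mathbf{x})=(P_{\mathbf{j}^{(1)}}(\mathbf{x}),\ldots,P_{\mathbf{j}^{(K_{N,l})}}(\mathbf{x}))^T$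 satisfies $\int_{\mathbb{A}^N}\mathbf{x}_r\mathbf{P}_l^T(\mathbf{x})f_{\mathbf{X}}(\mathbf{x})d\mathbf{x}=\mathbf{0}$ for all $r<l$, and the matrix $\mathbf{S}_l=\int_{\mathbb{A}^N}\mathbf{x}_l\mathbf{P}_l^T(\mathbf{x})f_{\mathbf{X}}(\mathbf{x})d\mathbf{x}$ is invertible. Orthonormal polynomials: the polynomial moment matrix $\mathbf{G}_l=\mathbb{E}[\mathbf{P}_l(\mathbf{X})\mathbf{P}_l^T(\mathbf{X})]$ is symmetric positive-definite; fix for each $l$ a non-singular whitening matrix $\mathbf{W}_l\in\mathbb{R}^{K_{N,l}\times K_{N,l}}$ with $\mathbf{W}_l^T\mathbf{W}_l=\mathbf{G}_l^{-1}$ (with $\mathbf{W}_0=[1]$) and set $\mathbf{\Psi}_l(\mathbf{x})=\mathbf{W}_l\mathbf{P}_l(\mathbf{x})$.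
   Formalization: The function y is assumed Borel measurable on the domain, and convergence in distribution is stated at each ξ where F is continuous; continuity of F_m and F is not asserted, since it fails, for example, for constant y. *)

(* Defs.v *)
From HB Require Import structures.
From mathcomp Require Import all_boot all_order all_algebra.
From mathcomp Require Import all_classical all_reals all_analysis.
From mathcomp Require Import measurable_realfun.
From mathcomp Require Import lra.

Set Implicit Arguments.
Unset Strict Implicit.
Unset Printing Implicit Defensive.

Import Order.TTheory GRing.Theory Num.Theory.
Import numFieldNormedType.Exports.

Local Open Scope classical_set_scope.
Local Open Scope ring_scope.

Definition rV_borel (R : realType) (n : nat) : set (set 'rV[R]_n) := <<s open >>.

Lemma rV_borel0 (R : realType) n : @rV_borel R n set0.
Proof. exact: sigma_algebra0. Qed.

Lemma rV_borelC (R : realType) n (A : set 'rV[R]_n) :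
  rV_borel A -> rV_borel (~` A).
Proof. by move=> mA; rewrite -setTD; exact: sigma_algebraCD. Qed.

Lemma rV_borel_bigcup (R : realType) n (F : (set 'rV[R]_n)^nat) :
  (forall i, rV_borel (F i)) -> rV_borel (\bigcup_i F i).
Proof. exact: sigma_algebra_bigcup. Qed.

Definition rV_display (R : realType) (n : nat) : measure_display :=
  sigma_display (@rV_borel R n).

HB.instance Definition _ (R : realType) (n : nat) :=
  @isMeasurable.Build (rV_display R n) 'rV[R]_n
    (@rV_borel R n) (@rV_borel0 R n) (@rV_borelC R n) (@rV_borel_bigcup R n).

Lemma open_measurable_rV (R : realType) n (U : set 'rV[R]_n) :
  open U -> measurable U.
Proof. by move=> oU; exact: sub_sigma_algebra. Qed.

Lemma measurable_coord_rV (R : realType) n (i : 'I_n) :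
  measurable_fun setT (fun x : 'rV[R]_n => x ord0 i).
Proof.
apply: (measurability _ (RGenOpens.measurableE R)).
move=> _ [_ [a [b ->]] <-]; rewrite setTI; apply: open_measurable_rV.
apply: open_comp; last exact: interval_open.
by move=> x _; exact: coord_continuous.
Qed.

Lemma rat_approx (R : realType) (a e : R) : 0 < e ->
  exists q : rat, `|ratr q - a| < e.
Proof.
move=> e0; have /rat_in_itvoo[q] : a - e < a + e by lra.
by rewrite in_itv /= => qe; exists q; rewrite ltr_distl.
Qed.

Lemma measurable_rV (R : realType) d (T : measurableType d) n
    (g : T -> 'rV[R]_n) :
  (forall i, measurable_fun setT (fun t => g t ord0 i)) ->
  measurable_fun setT g.
Proof.
move=> mg; apply: (measurability (@open 'rV[R]_n)) => // _ [U oU <-].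
rewrite setTI.
pose D := [set q : 'rV[rat]_n * rat |
  0 < q.2 /\ ball (map_mx ratr q.1 : 'rV[R]_n) (ratr q.2 : R) `<=` U].
have -> : g @^-1` U = \bigcup_(q : 'rV[rat]_n * rat)
    (if q \in D then \bigcap_(i : 'I_n)
       [set t | `|ratr (q.1 ord0 i) - g t ord0 i| < ratr q.2 :> R] else set0).
  apply/seteqP; split=> [t /= Ut|t [q _]].
  - have /nbhs_ballP[e /= e0 eU] := open_nbhs_nbhs (conj oU Ut).
    have [r re] : exists r : rat, `|ratr r - e / 3| < e / 6 :> R.
      by apply: rat_approx; rewrite divr_gt0.
    have r0 : e / 6 < ratr r :> R.
      by move: re; rewrite ltr_distl => /andP[re _]; lra.
    have re2 : ratr r < e / 2 :> R.
      by move: re; rewrite ltr_distl => /andP[_ re]; lra.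
    have /choice[c cP] : forall i, exists q : rat,
        `|ratr q - g t ord0 i| < ratr r :> R.
      by move=> i; apply: rat_approx; apply: lt_trans r0; rewrite divr_gt0.
    exists (\row_i c i, r) => //=.
    rewrite ifT; first by move=> i _ /=; rewrite mxE.
    rewrite inE; split=> /=.
      by rewrite -(ltr0q R); apply: lt_trans r0; rewrite divr_gt0.
    move=> x [_ cx]; apply: eU; split=> // i j.
    have := cx i j; rewrite !mxE !ord1 /ball /= => cxj.
    rewrite -(subrK (ratr (c j)) (g t ord0 j)) -addrA.
    apply: (le_lt_trans (ler_normD _ _)); rewrite distrC.
    by have := cP j; lra.
  - case: ifPn => // /set_mem[q0 qU] qt; apply: qU; split=> [|i j].
      by rewrite ltr0q.
    by rewrite ord1 mxE; exact: qt.
apply: countable_bigcupT_measurable => [|q]; first exact: countableP.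
case: ifPn => // _; apply: fin_bigcap_measurable => // i _.
rewrite (_ : [set t | _] = (fun t => `|ratr (q.1 ord0 i) - g t ord0 i|) @^-1`
   `]-oo, (ratr q.2)[%classic); last first.
  by apply/seteqP; split=> t /=; rewrite in_itv.
rewrite -[X in measurable X]setTI.
have mN : measurable_fun setT (fun t => `|ratr (q.1 ord0 i) - g t ord0 i|).
  by apply: measurableT_comp => //; exact: measurable_funB.
by apply: mN => //; exact: measurable_itv.
Qed.

Definition rV_cons (R : realType) n (p : R * 'rV[R]_n) : 'rV[R]_n.+1 :=
  row_mx p.1%:M p.2.

Lemma measurable_rV_cons (R : realType) n :
  measurable_fun setT (@rV_cons R n).
Proof.
apply: measurable_rV => i; case: (unliftP ord0 i) => [j ->|->].
  apply: (eq_measurable_fun ((fun x : 'rV[R]_n => x ord0 j) \o snd)).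
    move=> p _ /=; rewrite /rV_cons.
    have -> : lift ord0 j = rshift 1 j by exact/val_inj.
    exact/esym/(row_mxEr (p.1%:M : 'M[R]_1) p.2 ord0 j).
  by apply: measurableT_comp; [exact: measurable_coord_rV|exact: measurable_snd].
apply: (eq_measurable_fun fst); last exact: measurable_fst.
move=> p _; rewrite /rV_cons.
have -> : ord0 = lshift n (ord0 : 'I_1) by exact/val_inj.
by rewrite (row_mxEl (p.1%:M : 'M[R]_1) p.2) mxE eqxx mulr1n.
Qed.

Definition rV_uncons (R : realType) n (x : 'rV[R]_n.+1) : R * 'rV[R]_n :=
  (x ord0 ord0, rsubmx (x : 'rV[R]_(1 + n))).

Lemma measurable_rV_uncons (R : realType) n :
  measurable_fun setT (@rV_uncons R n).
Proof.
apply: measurable_fun_pair; first exact: measurable_coord_rV.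
apply: measurable_rV => i.
apply: (eq_measurable_fun (fun x : 'rV[R]_n.+1 => x ord0 (rshift 1 i))).
  by move=> x _; rewrite mxE.
exact: measurable_coord_rV.
Qed.

Lemma rV_consK (R : realType) n : cancel (@rV_cons R n) (@rV_uncons R n).
Proof.
move=> [a x]; rewrite /rV_cons /rV_uncons row_mxKr; congr pair.
have -> : ord0 = lshift n (ord0 : 'I_1) by exact/val_inj.
by rewrite (row_mxEl (a%:M : 'M[R]_1) x) mxE eqxx mulr1n.
Qed.

(* The measure on R^(n+1) corresponding to (Lebesgue measure on R) x mu. *)
Definition rV_prod (R : realType) n (mu : set 'rV[R]_n -> \bar R)
    : set 'rV[R]_n.+1 -> \bar R :=
  pushforward (@lebesgue_measure R \x mu)%E (@rV_cons R n).

Lemma rV_prod0 (R : realType) n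
    (mu : {sigma_finite_measure set 'rV[R]_n -> \bar R}) :
  rV_prod mu set0 = 0%E.
Proof. by rewrite /rV_prod /pushforward preimage_set0 measure0. Qed.

Lemma rV_prod_ge0 (R : realType) n
    (mu : {sigma_finite_measure set 'rV[R]_n -> \bar R}) A :
  (0 <= rV_prod mu A)%E.
Proof. by rewrite /rV_prod /pushforward measure_ge0. Qed.

Lemma rV_prod_sigma_additive (R : realType) n
    (mu : {sigma_finite_measure set 'rV[R]_n -> \bar R}) :
  semi_sigma_additive (rV_prod mu).
Proof.
move=> F mF tF mUF; rewrite /rV_prod /pushforward preimage_bigcup.
have mc := @measurable_rV_cons R n.
apply: measure_semi_sigma_additive.
- by move=> k; rewrite -[X in measurable X]setTI; exact: mc.
- apply/trivIsetP => /= i j _ _ ij; rewrite -preimage_setI.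
  by move/trivIsetP : tF => /(_ _ _ _ _ ij) ->//; rewrite preimage_set0.
- by rewrite -preimage_bigcup -[X in measurable X]setTI; exact: mc.
Qed.

HB.instance Definition _ (R : realType) n
    (mu : {sigma_finite_measure set 'rV[R]_n -> \bar R}) :=
  isMeasure.Build _ _ _ (rV_prod mu) (rV_prod0 mu) (rV_prod_ge0 mu)
    (@rV_prod_sigma_additive R n mu).

Lemma rV_prod_sigma_finite (R : realType) n
    (mu : {sigma_finite_measure set 'rV[R]_n -> \bar R}) :
  sigma_finite setT (rV_prod mu).
Proof.
have /sigma_finiteP[F [TF ndF Foo]] := sigma_finiteT (@lebesgue_measure R).
have /sigma_finiteP[G [TG ndG Goo]] := sigma_finiteT mu.
exists (fun k => @rV_uncons R n @^-1` (F k `*` G k)).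
  rewrite -preimage_bigcup -[LHS](preimage_setT (@rV_uncons R n)).
  congr (_ @^-1` _); apply/esym; rewrite -subTset => -[a x] _.
  have [i _ Fi] : (\bigcup_i F i) a by rewrite -TF.
  have [j _ Gj] : (\bigcup_i G i) x by rewrite -TG.
  exists (maxn i j) => //; split => /=.
    by move: a Fi; exact/subsetPset/ndF/leq_maxl.
  by move: x Gj; exact/subsetPset/ndG/leq_maxr.
move=> k; have [mF Fk] := Foo k; have [mG Gk] := Goo k; split.
  rewrite -[X in measurable X]setTI; apply: measurable_rV_uncons => //.
  exact: measurableX.
rewrite /rV_prod /pushforward -comp_preimage.
rewrite (_ : _ \o _ = id) ?preimage_id; last first.
  by apply/funext => p /=; rewrite rV_consK.
by rewrite product_measure1E// lte_mul_pinfty// ge0_fin_numE.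
Qed.

HB.instance Definition _ (R : realType) n
    (mu : {sigma_finite_measure set 'rV[R]_n -> \bar R}) :=
  @Measure_isSigmaFinite.Build _ _ _ (rV_prod mu) (rV_prod_sigma_finite mu).

(* n-dimensional Lebesgue measure, as an iterated product *)
Fixpoint lebesgue_rV (R : realType) (n : nat)
    : {sigma_finite_measure set 'rV[R]_n -> \bar R} :=
  if n is n'.+1 then rV_prod (lebesgue_rV R n') else \d_(0 : 'rV[R]_0).

Definition mindex (N : nat) := {ffun 'I_N -> nat}.

Definition mabs N (j : mindex N) : nat := (\sum_i j i)%N.

Definition monom (R : realType) N (j : mindex N) (x : 'rV[R]_N) : R :=
  \prod_i x ord0 i ^+ j i.

Definition poly_space (R : realType) N (m : nat) : set ('rV[R]_N -> R) :=
  [set p | exists (s : seq (mindex N)) (c : mindex N -> R),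
     all (fun j => mabs j <= m)%N s /\
     p = fun x => \sum_(j <- s) c j * monom j x].

Definition is_norm (R : realType) N (nrm : 'rV[R]_N -> R) : Prop :=
  [/\ forall x y, nrm (x + y) <= nrm x + nrm y,
      forall a x, nrm (a *: x) = `|a| * nrm x &
      forall x, nrm x = 0 -> x = 0].

(* The density is taken to be 0 outside A, and only its restriction to A is
   required to be continuous, so that for instance the uniform density on a
   compact box is covered. *)
Record input_assumption (R : realType) d (T : measurableType d)
    (P : probability T R) N (A : set 'rV[R]_N) (X : {RV P >-> 'rV[R]_N})
    (f nrm : 'rV[R]_N -> R) : Prop := {
  input_borel : measurable A;
  input_range : forall w, A (X w);
  density_ge0 : forall x, 0 <= f x;
  density_out : forall x, ~ A x -> f x = 0;
  density_continuous : {within A, continuous f};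
  density_support : closure [set x | f x != 0] = closure A;
  density_law : forall B, measurable B ->
    distribution P X B = (\int[lebesgue_rV R N]_(x in B) (f x)%:E)%E;
  finite_moments : forall j : mindex N,
    (\int[lebesgue_rV R N]_(x in A) (`|monom j x| * f x)%:E < +oo)%E;
  compact_or_exp_integrable :
    (exists K : set 'rV[R]_N, compact K /\ distribution P X K = 1%E) \/
    (exists alpha : R, 0 < alpha /\
      (\int[lebesgue_rV R N]_(x in A) (expR (alpha * nrm x) * f x)%:E
         < +oo)%E)
}.

Definition monomial_order N (le : rel (mindex N)) : Prop :=
  [/\ total le, antisymmetric le, transitive le,
      forall j k h : mindex N, le j k ->
        le [ffun i => j i + h i]%N [ffun i => k i + h i]%N &
      well_founded (fun j k => le j k && (j != k))].

Definition nmonom (N l : nat) : nat := 'C(N + l - 1, l).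

(* [idx l] lists the multi-indices of total degree l increasingly. No
   generality is lost on decreasing listings: they are increasing for the graded
   monomial order that reverses [le] within each degree. *)
Definition monomial_listing N (le : rel (mindex N))
    (idx : forall l, 'I_(nmonom N l) -> mindex N) : Prop :=
  forall l, [/\ forall i, mabs (idx l i) = l,
                forall j, mabs j = l -> exists i, idx l i = j &
                forall i k : 'I_(nmonom N l), (i < k)%N ->
                  le (idx l i) (idx l k) && (idx l i != idx l k)].

Definition monom_vec (R : realType) N
    (idx : forall l, 'I_(nmonom N l) -> mindex N) (l : nat) (x : 'rV[R]_N) :
    'cV[R]_(nmonom N l) := \col_i monom (idx l i) x.

Definition poly_vec (R : realType) N
    (idx : forall l, 'I_(nmonom N l) -> mindex N)
    (p : mindex N -> 'rV[R]_N -> R) (l : nat) (x : 'rV[R]_N) :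
    'cV[R]_(nmonom N l) := \col_i p (idx l i) x.

Definition mx_integral (R : realType) N (A : set 'rV[R]_N) (f : 'rV[R]_N -> R)
    m n (M : 'rV[R]_N -> 'M[R]_(m, n)) : 'M[R]_(m, n) :=
  \matrix_(i, k) \int[lebesgue_rV R N]_(x in A) (M x i k * f x).

Definition mx_expectation (R : realType) d (T : measurableType d)
    (P : probability T R) m n (M : T -> 'M[R]_(m, n)) : 'M[R]_(m, n) :=
  \matrix_(i, k) fine ('E_P[fun w => M w i k])%E.

Record orthogonal_polynomials (R : realType) N (A : set 'rV[R]_N)
    (f : 'rV[R]_N -> R) (idx : forall l, 'I_(nmonom N l) -> mindex N)
    (p : mindex N -> 'rV[R]_N -> R) : Prop := {
  orthopoly0 : p [ffun=> 0%N] = cst 1;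
  orthopoly_deg : forall j, poly_space (mabs j) (p j);
  orthopoly_orth : forall r l : nat, (r < l)%N ->
    mx_integral A f (fun x => monom_vec idx r x *m (poly_vec idx p l x)^T) = 0;
  orthopoly_inv : forall l : nat,
    mx_integral A f (fun x => monom_vec idx l x *m (poly_vec idx p l x)^T)
      \in unitmx
}.

Definition moment_matrix (R : realType) d (T : measurableType d)
    (P : probability T R) N (X : T -> 'rV[R]_N)
    (idx : forall l, 'I_(nmonom N l) -> mindex N)
    (p : mindex N -> 'rV[R]_N -> R) (l : nat) : 'M[R]_(nmonom N l) :=
  mx_expectation P
    (fun w => poly_vec idx p l (X w) *m (poly_vec idx p l (X w))^T).

Record whitening (R : realType) d (T : measurableType d)
    (P : probability T R) N (X : T -> 'rV[R]_N)
    (idx : forall l, 'I_(nmonom N l) -> mindex N)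
    (p : mindex N -> 'rV[R]_N -> R)
    (W : forall l, 'M[R]_(nmonom N l)) : Prop := {
  whitening_unit : forall l, W l \in unitmx;
  whiteningE : forall l, (W l)^T *m W l = invmx (moment_matrix P X idx p l);
  whitening0 : W 0%N = 1%:M
}.

Definition orthonormal_vec (R : realType) N
    (idx : forall l, 'I_(nmonom N l) -> mindex N)
    (p : mindex N -> 'rV[R]_N -> R) (W : forall l, 'M[R]_(nmonom N l))
    (l : nat) (x : 'rV[R]_N) : 'cV[R]_(nmonom N l) :=
  W l *m poly_vec idx p l x.

Definition pce_coef (R : realType) d (T : measurableType d)
    (P : probability T R) N (X : T -> 'rV[R]_N) (y : 'rV[R]_N -> R)
    (Psi : forall l, 'rV[R]_N -> 'cV[R]_(nmonom N l)) (l : nat) :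
    'cV[R]_(nmonom N l) :=
  mx_expectation P (fun w => y (X w) *: Psi l (X w)).

Definition pce_term (R : realType) d (T : measurableType d)
    (P : probability T R) N (X : T -> 'rV[R]_N) (y : 'rV[R]_N -> R)
    (Psi : forall l, 'rV[R]_N -> 'cV[R]_(nmonom N l)) (l : nat) (w : T) : R :=
  ((pce_coef P X y Psi l)^T *m Psi l (X w)) ord0 ord0.

Definition pce_approx (R : realType) d (T : measurableType d)
    (P : probability T R) N (X : T -> 'rV[R]_N) (y : 'rV[R]_N -> R)
    (Psi : forall l, 'rV[R]_N -> 'cV[R]_(nmonom N l)) (m : nat) (w : T) : R :=
  \sum_(l < m.+1) pce_term P X y Psi l w.

(* Y is the sum of the series of the u_l in the space L^2(P). *)
Definition L2_series_sum (R : realType) d (T : measurableType d)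
    (P : probability T R) (u : nat -> T -> R) (Y : T -> R) : Prop :=
  [/\ forall l, u l \in Lfun P 2%:E, Y \in Lfun P 2%:E &
      ('N[P]_2%:E [(fun w => (\sum_(l < m) u l w - Y w)%R%:E)])%E
        @[m --> \oo] --> 0%E].

Definition distribution_function (R : realType) d (T : measurableType d)
    (P : probability T R) (Z : T -> R) (xi : R) : R :=
  fine (P [set w | Z w <= xi]).

(* Main.v *)
Require Import Defs.
From HB Require Import structures.
From mathcomp Require Import all_boot all_order all_algebra.
From mathcomp Require Import all_classical all_reals all_analysis.
From mathcomp Require Import measurable_realfun.
From mathcomp Require Import lra ring.

Set Implicit Arguments.
Unset Strict Implicit.
Unset Printing Implicit Defensive.

Import Order.TTheory GRing.Theory Num.Theory.
Import numFieldNormedType.Exports.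

Local Open Scope classical_set_scope.
Local Open Scope ring_scope.

(** The partial sums of the expansion are the orthogonal projections of [y(X)]
    onto the polynomials of bounded degree in [X], so everything rests on the
    density of the polynomials in the space L2 of the law [mu] of [X].

    Density. Some exponential moment of every coordinate is finite: this is
    clear when the law is carried by a compact set, and otherwise it follows
    from the given integrability since every norm of a finite-dimensional space
    dominates the coordinates ([is_norm_coord]). Let [cl] be the closure of the
    polynomials in mean square, and call a bounded measurable function [g] a
    multiplier if [g q] is in [cl] for every polynomial [q]. The multipliers
    form an algebra that is stable under bounded pointwise limits, by dominated
    convergence. For small [c] the function [sin (c x_i)] is a multiplier: times
    a polynomial, its Taylor series has polynomial partial sums and is dominated
    by [exp (c |x_i|)] times that polynomial, which is square integrable
    ([multiplier_sin]). A suitable sequence of polynomials in one variable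
    converges boundedly to a step function on [[0, 1]] ([step_poly_cvg]), so the
    indicator of [g > a] is a multiplier as soon as [g] is ([multiplier_gt]).
    The sets whose indicators are multipliers form a sigma-algebra; it makes
    every [sin (c x_i)], hence every [x_i] as a pointwise limit of
    [sin (c x_i) / c], measurable, so that it contains all Borel sets
    ([borel_multiplier]). As 1 is a polynomial, the simple functions are in
    [cl], and therefore so is every square-integrable function
    ([polyfun_dense]).

    Projection. The whitening matrix is invertible, which forces the moment
    matrix to be invertible and the whitened polynomials to be orthonormal
    ([inner_orthonormal]). The moment matrix is the product of the matrix of
    top-degree coefficients of the orthogonal polynomials with the matrix of
    their pairings with the monomials, so the former is invertible
    ([leading_matrix]). By induction on the degree, a function orthogonal to the
    orthonormal polynomials of degree at most [m] is orthogonal to all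
    polynomials of degree at most [m] ([orthogonal_monoms]). Applied to the
    residual of the partial sum, this and the theorem of Pythagoras show that
    the mean-square error is at most that of any polynomial of the same degree
    ([pce_best_approximation]), and density makes it tend to 0.

    The two weaker modes of convergence follow from the Markov inequality and
    from the continuity of the limiting distribution function at the point
    considered. *)

(** * Closure in mean square *)

Lemma norm_cvg_le (R : realType) (u : R^nat) (l C : R) :
  (forall n, `|u n| <= C) -> u n @[n --> \oo] --> l -> `|l| <= C.
Proof.
move=> uC /cvg_norm ul; rewrite -(cvg_lim _ ul)//.
by apply: limr_le; [exact: cvgP ul|exact: nearW].
Qed.

Section l2_closure.
Context d (T : measurableType d) (R : realType).
Variable mu : {measure set T -> \bar R}.
Implicit Types (g h k q : T -> R) (V : set (T -> R)).

Definition sqdist g h : \bar R := (\int[mu]_x ((g x - h x) ^+ 2)%:E)%E.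

Definition l2_closure V : set (T -> R) :=
  [set g | measurable_fun setT g /\
    forall e : R, 0 < e -> exists2 q, V q & (sqdist g q < e%:E)%E].

Lemma measurable_sqr_EFin g : measurable_fun setT g ->
  measurable_fun setT (fun x => (g x ^+ 2)%:E).
Proof. by move=> mg; apply/measurable_EFinP; exact: measurable_funX. Qed.

(** Squared distances obey the triangle inequality up to a factor 2, which is
    enough for closures and avoids square roots of extended reals. *)
Lemma sqdist_triangle g h k : measurable_fun setT g -> measurable_fun setT h ->
    measurable_fun setT k ->
  (sqdist g k <= 2%:E * (sqdist g h + sqdist h k))%E.
Proof.
move=> mg mh mk.
have mgh := measurable_sqr_EFin (measurable_funB mg mh).
have mhk := measurable_sqr_EFin (measurable_funB mh mk).
have mgk := measurable_sqr_EFin (measurable_funB mg mk).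
rewrite /sqdist -ge0_integralD//; try by move=> x _; rewrite lee_fin sqr_ge0.
rewrite -ge0_integralZl//; last 2 first.
- exact: emeasurable_funD.
- by move=> x _; rewrite adde_ge0// lee_fin sqr_ge0.
apply: ge0_le_integral => //.
- by move=> x _; rewrite lee_fin sqr_ge0.
- by apply: emeasurable_funM => //; exact: emeasurable_funD.
move=> x _; rewrite -EFinD -EFinM lee_fin.
by have := sqr_ge0 ((g x - h x) - (h x - k x)); nra.
Qed.

Lemma sqdist_bounded_mul g h k (C : R) : (forall x, `|g x| <= C) ->
    measurable_fun setT g -> measurable_fun setT h -> measurable_fun setT k ->
  (sqdist (g \* h)%R (g \* k)%R <= (C ^+ 2)%:E * sqdist h k)%E.
Proof.
move=> gC mg mh mk; rewrite /sqdist -ge0_integralZl//; last 3 first.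
- exact/measurable_sqr_EFin/measurable_funB.
- by move=> x _; rewrite lee_fin sqr_ge0.
- by rewrite lee_fin sqr_ge0.
apply: ge0_le_integral => //.
- by move=> x _; rewrite lee_fin sqr_ge0.
- by apply: measurable_sqr_EFin; apply: measurable_funB; exact: measurable_funM.
- by apply: emeasurable_funM => //; exact/measurable_sqr_EFin/measurable_funB.
move=> x _; rewrite -EFinM lee_fin /= -mulrBr exprMn ler_wpM2r ?sqr_ge0//.
rewrite -(ger0_norm (sqr_ge0 (g x))) normrX lerXn2r ?nnegrE//.
exact: le_trans (gC x).
Qed.

Lemma sqdistxx g : sqdist g g = 0%E.
Proof. by rewrite /sqdist integral0_eq// => x _; rewrite subrr expr0n. Qed.

Lemma sub_l2_closure V : (forall q, V q -> measurable_fun setT q) ->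
  V `<=` l2_closure V.
Proof.
move=> mV q Vq; split; first exact: mV.
by move=> e e0; exists q => //; rewrite sqdistxx lte_fin.
Qed.

Lemma l2_closure_idem V : (forall q, V q -> measurable_fun setT q) ->
  l2_closure (l2_closure V) `<=` l2_closure V.
Proof.
move=> mV g [mg cg]; split => // e e0.
have e4 : 0 < e / 4 by rewrite divr_gt0.
have [h [mh ch] gh] := cg _ e4; have [q Vq hq] := ch _ e4.
exists q => //; apply: (le_lt_trans (sqdist_triangle mg mh (mV _ Vq))).
have -> : e%:E = (2%:E * ((e / 4)%:E + (e / 4)%:E))%E.
  by rewrite -EFinD -EFinM; congr EFin; lra.
by rewrite lte_pmul2l// lteD.
Qed.

(** By dominated convergence, as [(g_ n - g)^2 <= 4 h^2]. *)
Lemma l2_closure_dominated V (g_ : (T -> R)^nat) g h :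
    (forall q, V q -> measurable_fun setT q) ->
    (forall n, l2_closure V (g_ n)) -> measurable_fun setT g ->
    measurable_fun setT h -> (\int[mu]_x (h x ^+ 2)%:E < +oo)%E ->
    (forall n x, `|g_ n x| <= h x) ->
    (forall x, g_ n x @[n --> \oo] --> g x) ->
  l2_closure V g.
Proof.
move=> mV Vg_ mg mh hoo g_h g_g; apply: l2_closure_idem => //.
have mg_ n : measurable_fun setT (g_ n) by have [] := Vg_ n.
have gh x : `|g x| <= h x by exact: norm_cvg_le (g_g x).
split => // e e0.
have h0 x : 0 <= h x by exact: le_trans (gh x).
have [|||||_ _] := @dominated_convergence _ _ _ mu setT measurableT
  (fun n x => ((g_ n x - g x) ^+ 2)%:E) (cst 0%E) (fun x => (4 * h x ^+ 2)%:E).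
- by move=> n; exact/measurable_sqr_EFin/measurable_funB.
- exact: measurable_cst.
- apply: aeW => x _; apply/cvg_EFin; first exact: nearW.
  rewrite /comp /=; have -> : 0 = (g x - g x) ^+ 2 :> R by rewrite subrr expr0n.
  under eq_fun do rewrite expr2.
  by apply: cvgM; apply: cvgB => //; exact: cvg_cst.
- under eq_fun do rewrite EFinM; apply: integrableZl => //.
  apply/integrableP; split; first exact: measurable_sqr_EFin.
  by under eq_integral do rewrite gee0_abs ?lee_fin ?sqr_ge0//.
- apply: aeW => x n _; rewrite gee0_abs ?lee_fin ?sqr_ge0//.
  have := g_h n x; have := gh x; rewrite !ler_norml => /andP[? ?] /andP[? ?].
  by nra.
rewrite integral_cst// mul0e => /fine_cvgP[fin_near /cvgr_lt /(_ e e0)].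
move=> lt_near; have [n []] := filter_ex (filterI fin_near lt_near).
move=> /= fin_n lt_n; exists (g_ n) => //.
rewrite /sqdist; under eq_integral do rewrite -sqrrN opprB.
by rewrite -(fineK fin_n) lte_fin.
Qed.

End l2_closure.

(** * Polynomials approximating a step function *)

Section step_polynomials.
Context (R : realType).
Implicit Types (s t z : R).

(** For [t] in [[0, 1]], [(1 - t^(2n))^M] is close to 1 or to 0 according to
    whether [M t^(2n)] is small or large. With [M = n 4^n] this product is
    [n (2t)^(2n)]: it tends to 0 for [t < 1/2] and, thanks to the factor [n],
    to infinity for all [t >= 1/2], the endpoint included. *)
Definition step_poly (n : nat) t : R := (1 - t ^+ (n + n)) ^+ (n * 4 ^ n).

Lemma step_poly_itv n t : 0 <= t <= 1 -> 0 <= step_poly n t <= 1.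
Proof.
move=> /andP[t0 t1]; have t2 : 0 <= t ^+ (n + n) <= 1.
  by rewrite exprn_ge0//= exprn_ile1.
move: t2 => /andP[? ?].
by rewrite /step_poly exprn_ge0 ?exprn_ile1//; lra.
Qed.

Lemma bernoulli_sub (N : nat) s : 0 <= s <= 1 -> 1 - N%:R * s <= (1 - s) ^+ N.
Proof.
move=> /andP[s0 s1]; elim: N => [|N IH]; first by rewrite mul0r subr0 expr0.
have Nss : 0 <= N%:R * s * s by rewrite !mulr_ge0.
rewrite exprS -natr1; set u := _ ^+ N in IH *.
have : (1 - s) * (1 - N%:R * s) <= (1 - s) * u by rewrite ler_wpM2l// subr_ge0.
by lra.
Qed.

Lemma bernoulli_add (N : nat) s : 0 <= s -> 1 + N%:R * s <= (1 + s) ^+ N.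
Proof.
move=> s0; elim: N => [|N IH]; first by rewrite mul0r addr0 expr0.
have Nss : 0 <= N%:R * s * s by rewrite !mulr_ge0.
rewrite exprS -natr1; set u := _ ^+ N in IH *.
have : (1 + s) * (1 + N%:R * s) <= (1 + s) * u by rewrite ler_wpM2l// addr_ge0.
by lra.
Qed.

(** [n z^n] is at most the sum of the [z^k] for [k < n]. *)
Lemma natmul_expr_bound n z : 0 <= z <= 1 ->
  n%:R * z ^+ n * (1 - z) <= 1 - z ^+ n.
Proof.
move=> /andP[z0 z1]; elim: n => [|n IH]; first by rewrite !mul0r subrr.
have : 0 <= z ^+ n <= 1 by rewrite exprn_ge0//= exprn_ile1.
rewrite exprS -natr1; set u := _ ^+ n in IH * => /andP[u0 u1].
have := ler_wpM2l z0 IH.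
have : 0 <= (1 - z) * (1 - z * u) by rewrite mulr_ge0 ?subr_ge0// mulr_ile1.
by lra.
Qed.

Lemma step_exponentE n t :
  (n * 4 ^ n)%:R * t ^+ (n + n) = n%:R * ((t *+ 2) ^+ n) ^+ 2 :> R.
Proof.
rewrite natrM natrX -mulrA; congr *%R.
rewrite exprD -[t *+ 2]mulr_natl exprMn.
have -> : 4%:R ^+ n = (2%:R ^+ n) ^+ 2 :> R.
  by rewrite -exprM mulnC exprM expr2 -natrM.
by ring.
Qed.

(** Both cases are instances of the Bernoulli inequality, used for
    [t >= 1/2] through [(1 - s)^M (1 + s)^M <= 1]. *)
Lemma step_poly_cvg t : 0 <= t <= 1 ->
  step_poly n t @[n --> \oo] --> ((t < 2^-1)%R%:R : R).
Proof.
move=> /[dup] t01 /andP[t0 t1]; case: ltP => [tlt|tge]; last first.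
  apply: (@squeeze_cvgr _ _ _ _ (cst 0) (@harmonic R)); last 2 first.
  - exact: cvg_cst.
  - exact: cvg_harmonic.
  apply: nearW => n /=; have /andP[-> _] /= := step_poly_itv n t01.
  rewrite /harmonic -[leRHS]mul1r ler_pdivlMr ?ltr0n//.
  set s := t ^+ (n + n); have s0 : 0 <= s by rewrite exprn_ge0.
  have s1 : s <= 1 by rewrite exprn_ile1.
  have : n.+1%:R <= (1 + s) ^+ (n * 4 ^ n).
    apply: le_trans (bernoulli_add _ s0); rewrite step_exponentE -natr1.
    have : 1 <= ((t *+ 2) ^+ n) ^+ 2 by rewrite !exprn_ege1//; lra.
    by have := ler0n R n; nra.
  rewrite /step_poly -/s => ns; have sn : 0 <= (1 - s) ^+ (n * 4 ^ n).
    by rewrite exprn_ge0//; lra.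
  apply: (le_trans (ler_wpM2l sn ns)); rewrite -exprMn exprn_ile1//; nra.
set z := t *+ 2; have z0 : 0 <= z by rewrite /z; lra.
have z1 : z < 1 by rewrite /z; lra.
have zn : z ^+ n @[n --> \oo] --> (0 : R) by apply: cvg_expr; rewrite ger0_norm.
(* n z^(2n) <= z^n / (1 - z), since n z^n (1 - z) <= 1 *)
apply: (@squeeze_cvgr _ _ _ _ (fun n => 1 - z ^+ n * (1 - z)^-1) (cst 1));
  last 2 first.
- rewrite -[X in _ --> X]subr0 -(mul0r (1 - z)^-1).
  by apply: cvgB; [exact: cvg_cst|apply: cvgM => //; exact: cvg_cst].
- exact: cvg_cst.
apply: nearW => n /=; have /andP[_ ->] /= := step_poly_itv n t01.
rewrite andbT; have s01 : 0 <= t ^+ (n + n) <= 1.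
  by rewrite exprn_ge0//= exprn_ile1.
apply: le_trans (bernoulli_sub _ s01).
rewrite step_exponentE -/z lerD2l lerN2.
have zn0 : 0 <= z ^+ n by rewrite exprn_ge0.
have /natmul_expr_bound : 0 <= z <= 1 by rewrite z0 ltW.
move=> /(_ n) nz; rewrite ler_pdivlMr ?subr_gt0// expr2.
by nra.
Qed.

End step_polynomials.

(** * Multipliers of a space of functions *)

Section multipliers.
Context d (T : measurableType d) (R : realType).
Variable mu : {measure set T -> \bar R}.
Variable V : set (T -> R).
Hypothesis V_measurable : forall q, V q -> measurable_fun setT q.
Hypothesis V_add : forall q r, V q -> V r -> V (fun x => q x + r x).
Hypothesis V_scale : forall a q, V q -> V (fun x => a * q x).
Hypothesis V_sqr : forall q, V q -> (\int[mu]_x (q x ^+ 2)%:E < +oo)%E.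
Implicit Types (g h k q : T -> R).

Lemma l2_closureD g h : l2_closure mu V g -> l2_closure mu V h ->
  l2_closure mu V (fun x => g x + h x).
Proof.
move=> [mg cg] [mh ch]; split; first exact: measurable_funD.
move=> e e0; have e4 : 0 < e / 4 by rewrite divr_gt0.
have [q Vq gq] := cg _ e4; have [r Vr hr] := ch _ e4.
have mq := V_measurable Vq; have mr := V_measurable Vr.
exists (fun x => q x + r x); first exact: V_add.
have mgh : measurable_fun setT (fun x => g x + h x) by exact: measurable_funD.
have mqh : measurable_fun setT (fun x => q x + h x) by exact: measurable_funD.
have mqr : measurable_fun setT (fun x => q x + r x) by exact: measurable_funD.
apply: (le_lt_trans (sqdist_triangle _ mgh mqh mqr)).
have -> : e%:E = (2%:E * ((e / 4)%:E + (e / 4)%:E))%E.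
  by rewrite -EFinD -EFinM; congr EFin; lra.
rewrite lte_pmul2l// lteD//.
  rewrite (_ : sqdist _ _ _ = sqdist mu g q)//.
  by apply: eq_integral => x _; congr (_ ^+ 2)%:E; lra.
rewrite (_ : sqdist _ _ _ = sqdist mu h r)//.
by apply: eq_integral => x _; congr (_ ^+ 2)%:E; lra.
Qed.

(** Multiplication by a bounded function is continuous in mean square, so it is
    enough to know its effect on [V]. *)
Lemma l2_closureM (C : R) g h : measurable_fun setT g ->
    (forall x, `|g x| <= C) ->
    (forall q, V q -> l2_closure mu V (fun x => g x * q x)) ->
  l2_closure mu V h -> l2_closure mu V (fun x => g x * h x).
Proof.
move=> mg gC gV [mh ch]; apply: l2_closure_idem => //.
split; first exact: measurable_funM.
move=> e e0; have eC : 0 < e / (C ^+ 2 + 1).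
  by rewrite divr_gt0// ltr_wpDl// sqr_ge0.
have [q Vq hq] := ch _ eC; exists (fun x => g x * q x); first exact: gV.
apply: (le_lt_trans (sqdist_bounded_mul _ gC mg mh (V_measurable Vq))).
rewrite (@le_lt_trans _ _ ((C ^+ 2)%:E * (e / (C ^+ 2 + 1))%:E)%E)//.
  by apply: lee_wpmul2l; [rewrite lee_fin sqr_ge0|exact: ltW].
rewrite -EFinM lte_fin mulrCA -[ltRHS]mulr1 ltr_pM2l//.
by rewrite ltr_pdivrMr ?mul1r ?ltrDl// ltr_wpDl// sqr_ge0.
Qed.

(** The multipliers are an algebra even when [V] is only a vector space and its
    closure is not stable under products. *)
Definition multiplier g := [/\ measurable_fun setT g,
  exists C, forall x, `|g x| <= C &
  forall q, V q -> l2_closure mu V (fun x => g x * q x)].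

Lemma multiplierD g h : multiplier g -> multiplier h ->
  multiplier (fun x => g x + h x).
Proof.
move=> [mg [C gC] Vg] [mh [D hD] Vh]; split; first exact: measurable_funD.
  by exists (C + D) => x; apply: (le_trans (ler_normD _ _)); exact: lerD.
move=> q Vq; under eq_fun do rewrite mulrDl.
by apply: l2_closureD; [exact: Vg|exact: Vh].
Qed.

Lemma multiplierM g h : multiplier g -> multiplier h ->
  multiplier (fun x => g x * h x).
Proof.
move=> [mg [C gC] Vg] [mh [D hD] Vh]; split; first exact: measurable_funM.
  exists (C * D) => x; rewrite normrM ler_pM//.
move=> q Vq; under eq_fun do rewrite -mulrA.
by apply: (l2_closureM mg gC) => //; exact: Vh.
Qed.

Lemma multiplier_cst c : multiplier (cst c).
Proof.
split; [exact: measurable_cst|by exists (`|c|)|] => q Vq.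
by apply: sub_l2_closure => //; exact: V_scale.
Qed.

Lemma multiplierX g n : multiplier g -> multiplier (fun x => g x ^+ n).
Proof.
move=> mg; elim: n => [|n IH].
  by under eq_fun do rewrite expr0; exact: multiplier_cst.
by under eq_fun do rewrite exprS; exact: multiplierM.
Qed.

Lemma multiplierZ a g : multiplier g -> multiplier (fun x => a * g x).
Proof. by move=> mg; apply: multiplierM => //; exact: multiplier_cst. Qed.

Lemma multiplierB g h : multiplier g -> multiplier h ->
  multiplier (fun x => g x - h x).
Proof.
move=> mg mh; under eq_fun do rewrite -mulN1r.
by apply: multiplierD => //; exact: multiplierZ.
Qed.

Lemma multiplier_sub1 g : multiplier g -> multiplier (fun x => 1 - g x).
Proof. by move=> mg; apply: multiplierB => //; exact: (multiplier_cst 1). Qed.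

Lemma multiplier_lim (g_ : (T -> R)^nat) g (C : R) :
    (forall n, multiplier (g_ n)) -> (forall n x, `|g_ n x| <= C) ->
    (forall x, g_ n x @[n --> \oo] --> g x) -> multiplier g.
Proof.
move=> mg_ g_C g_g.
have gC x : `|g x| <= C by exact: norm_cvg_le (g_g x).
have mg : measurable_fun setT g.
  apply: (@measurable_fun_cvg _ _ _ setT g_) => // n.
  by have [] := mg_ n.
split => //; first by exists C.
move=> q Vq; have mq := V_measurable Vq.
apply: (l2_closure_dominated (g_ := fun n x => g_ n x * q x)
  (h := fun x => C * `|q x|)) => //.
- by move=> n; have [_ _] := mg_ n; exact.
- exact: measurable_funM.
- by apply: measurable_funM => //; exact: measurableT_comp.
- under eq_integral do rewrite exprMn -normrX ger0_norm ?sqr_ge0// EFinM.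
  rewrite ge0_integralZl//; last 3 first.
  + exact: measurable_sqr_EFin.
  + by move=> x _; rewrite lee_fin sqr_ge0.
  + by rewrite lee_fin sqr_ge0.
  by rewrite lte_mul_pinfty ?lee_fin ?sqr_ge0// V_sqr.
- by move=> n x; rewrite normrM ler_wpM2r.
- by move=> x; apply: cvgM => //; exact: cvg_cst.
Qed.

(** The step polynomials, evaluated at an affine function of [g] that takes
    values in [[0, 1]] and is below [1/2] exactly where [a < g], converge
    boundedly to the indicator. *)
Lemma multiplier_gt g a : multiplier g -> multiplier \1_[set x | a < g x].
Proof.
move=> mg; have [_ [C gC] _] := mg.
have [[x0 _]|noT] := pselect (exists x : T, True); last first.
  rewrite (_ : \1__ = cst 0); first exact: multiplier_cst.
  by apply/funext => x; case: noT; exists x.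
have C0 : 0 <= C by exact: le_trans (gC x0).
(* a positive bound of |g - a| *)
pose K := C + `|a| + 1; have K0 : 0 < K by rewrite /K ltr_wpDl// addr_ge0.
pose t x := 2^-1 - (2 * K)^-1 * (g x - a).
have t01 x : 0 <= t x <= 1.
  have : `|g x - a| <= K.
    apply: (le_trans (ler_normB _ _)); rewrite /K; have := gC x; lra.
  rewrite ler_norml => /andP[gl gr].
  have : `|(2 * K)^-1 * (g x - a)| <= 2^-1.
    rewrite normrM ger0_norm ?invr_ge0 ?mulr_ge0 ?(ltW K0)//.
    rewrite mulrC ler_pdivrMr ?mulr_gt0// mulrA mulVf ?mul1r ?ler_norml ?gl//.
  by rewrite ler_norml /t => /andP[? ?]; lra.
have mt : multiplier t.
  apply: multiplierB; first exact: multiplier_cst.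
  by apply: multiplierZ; apply: multiplierB => //; exact: multiplier_cst.
apply: (@multiplier_lim (fun n x => step_poly n (t x)) _ 1).
- by move=> n; apply: multiplierX; apply: multiplier_sub1; exact: multiplierX.
- move=> n x; have /andP[s0 s1] := step_poly_itv n (t01 x).
  by rewrite ger0_norm.
- move=> x; have := step_poly_cvg (t01 x); congr (_ --> _).
  rewrite indicE /t; congr ((nat_of_bool _)%:R).
  rewrite gtrBl pmulr_rgt0 ?invr_gt0 ?mulr_gt0// subr_gt0.
  by apply/idP/idP => [h|/set_mem//]; exact/mem_set.
Qed.

Definition multiplier_set : set (set T) := [set B | multiplier \1_B].

(** Complements and finite unions are polynomial in the indicators, and the
    indicator of a countable union is a bounded limit of those of its finite
    subunions. *)
Lemma multiplier_set_sigma_algebra : sigma_algebra setT multiplier_set.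
Proof.
split.
- by rewrite /multiplier_set /= indic0; exact: multiplier_cst.
- move=> B mB; rewrite /multiplier_set /=.
  have -> : \1_(setT `\` B) = (fun x => 1 - \1_B x) :> (T -> R).
    apply/funext => x; rewrite setTD !indicE in_setC.
    by case: (x \in B); rewrite ?subr0 ?subrr.
  exact: multiplier_sub1.
- move=> F mF; rewrite /multiplier_set /=.
  have mU n : multiplier \1_(\big[setU/set0]_(i < n) F i).
    elim: n => [|n IH]; first by rewrite big_ord0 indic0; exact: multiplier_cst.
    rewrite big_ord_recr /=.
    have -> : \1_(\big[setU/set0]_(i < n) F i `|` F n) =
        (fun x => 1 - (1 - \1_(\big[setU/set0]_(i < n) F i) x) *
                      (1 - \1_(F n) x)) :> (T -> R).
      apply/funext => x; rewrite !indicE in_setU.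
      case: (x \in \big[setU/set0]_(i < n) F i); case: (x \in F n);
        rewrite /= ?subrr ?subr0 ?mul0r ?mulr0 ?mulr1 ?subr0 ?subrr//.
    apply/multiplier_sub1/multiplierM; apply: multiplier_sub1 => //.
    exact: mF.
  apply: (@multiplier_lim _ _ 1 mU).
    by move=> n x; rewrite indicE; case: (_ \in _); rewrite ?normr1 ?normr0.
  move=> x; apply: cvg_near_cst.
  have [[n _ Fnx]|nF] := pselect ((\bigcup_k F k) x); last first.
    have nFm m : ~ (\big[setU/set0]_(i < m) F i) x.
      by rewrite -bigcup_mkord => -[k _ Fkx]; apply: nF; exists k.
    by apply: nearW => m; rewrite !indicE (memNset nF) (memNset (nFm m)).
  have Ux : (\bigcup_k F k) x by exists n.
  near=> m; have Umx : (\big[setU/set0]_(i < m) F i) x.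
    rewrite -bigcup_mkord; exists n => //=.
    by near: m; exact: nbhs_infty_gt.
  by rewrite !indicE (mem_set Ux) (mem_set Umx).
Unshelve. all: by end_near. Qed.

End multipliers.

(** * Sines as multipliers and density in mean square *)

Lemma measurable_fun_gt d (T : measurableType d) (R : realType) (g : T -> R) :
  (forall a, measurable [set x | a < g x]) -> measurable_fun setT g.
Proof.
move=> mg; apply: (measurability _ (RGenOInfty.measurableE R)).
move=> _ [_ [a ->] <-]; rewrite setTI.
rewrite (_ : _ @^-1` _ = [set x | a < g x])//.
by apply/seteqP; split => x /=; rewrite in_itv /= andbT.
Qed.

(** The sine has derivative 1 at the origin. *)
Lemma sin_dilation_cvg (R : realType) (c x : R) : 0 < c ->
  (c / n.+1%:R)^-1 * sin (c / n.+1%:R * x) @[n --> \oo] --> x.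
Proof.
move=> c0; have [->|x0] := eqVneq x 0.
  by under eq_fun do rewrite mulr0 sin0 mulr0; exact: cvg_cst.
have h0 : c / n.+1%:R * x @[n --> \oo] --> (0 : R).
  rewrite -(mul0r x); apply: cvgM; last exact: cvg_cst.
  rewrite -[X in _ --> X](mulr0 c).
  by apply: cvgM; [exact: cvg_cst|exact: cvg_harmonic].
pose u n : R := c / n.+1%:R * x.
have u0 n : u n != 0 by rewrite mulf_neq0// gt_eqF// divr_gt0.
have u_dnbhs : u n @[n --> \oo] --> 0^'.
  move=> B; rewrite /dnbhs /within /= => /h0 hB.
  have : \forall n \near \oo, u n != 0 -> B (u n) by exact: hB.
  by move=> {}hB; apply: filterS hB => n; apply.
have sin'0 : h^-1 *: (sin (h *: 1 + 0) - sin 0) @[h --> 0^'] --> (1 : R).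
  have [dsin dE] := is_derive_sin (0 : R); rewrite cos0 in dE.
  by rewrite -[X in _ --> X]dE; exact: dsin.
have /(@cvgM _ _ _ _ _ (cst x)) /(_ (cvg_cst _)) := cvg_comp _ _ u_dnbhs sin'0.
rewrite mul1r; apply: cvg_trans; apply: near_eq_cvg; apply: nearW => n /=.
rewrite /u sin0 subr0 addr0 /GRing.scale/= mulr1 invfM.
by rewrite mulrAC [_ * x^-1 * x]mulfVK.
Qed.

Lemma norm_series_sin_coeff (R : realType) (x : R) n :
  `|series (sin_coeff x) n| <= expR `|x|.
Proof.
rewrite (le_trans (ler_norm_sum _ _ _))//.
apply: (@le_trans _ _ (series (exp_coeff `|x|) n)).
  apply: ler_sum => i _; rewrite /sin_coeff /exp_coeff /=.
  rewrite !normrM normfV !normr_nat !normrX normrN normr1 expr1n mulr1.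
  by case: odd; rewrite ?mul1r// !mul0r divr_ge0.
apply: nondecreasing_cvgn_le; last exact: is_cvg_series_exp_coeff.
by apply: nondecreasing_series => i _ _; exact: exp_coeff_ge0.
Qed.

Section density.
Context d (T : measurableType d) (R : realType).
Variable mu : {measure set T -> \bar R}.
Variable V : set (T -> R).
Hypothesis V_measurable : forall q, V q -> measurable_fun setT q.
Hypothesis V_add : forall q r, V q -> V r -> V (fun x => q x + r x).
Hypothesis V_scale : forall a q, V q -> V (fun x => a * q x).
Hypothesis V_sqr : forall q, V q -> (\int[mu]_x (q x ^+ 2)%:E < +oo)%E.
Implicit Types (g h k q : T -> R).

Lemma multiplier_sum (I : Type) (s : seq I) (F : I -> T -> R) :
  (forall i, multiplier mu V (F i)) ->
  multiplier mu V (fun x => \sum_(i <- s) F i x).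
Proof.
move=> mF; elim: s => [|i s IH].
  by under eq_fun do rewrite big_nil; exact: multiplier_cst.
by under eq_fun do rewrite big_cons; exact: multiplierD.
Qed.

(** The partial sums of the Taylor series of the sine, multiplied by [q], are in
    [V] and dominated by [expR |c X| * |q|]. *)
Lemma multiplier_sin (X : T -> R) (c : R) : measurable_fun setT X ->
    (forall q, V q -> V (fun x => X x * q x)) ->
    (forall q, V q -> (\int[mu]_x ((expR `|c * X x| * q x) ^+ 2)%:E < +oo)%E) ->
  multiplier mu V (fun x => sin (c * X x)).
Proof.
move=> mX VX expX.
have mcX : measurable_fun setT (fun x => c * X x) by exact: measurable_funM.
have msin : measurable_fun setT (fun x => sin (c * X x)).
  apply: (measurableT_comp _ mcX).
  by apply: continuous_measurable_fun; exact: continuous_sin.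
split => //.
  by exists 1 => x; rewrite ler_norml sin_geN1 sin_le1.
move=> q Vq.
have Vpow n : V (fun x => (c * X x) ^+ n * q x).
  elim: n => [|n IH]; first by under eq_fun do rewrite expr0 mul1r.
  under eq_fun do rewrite exprS -!mulrA.
  by apply: V_scale; exact: (VX _ IH).
have Vser n : V (fun x => series (sin_coeff (c * X x)) n * q x).
  elim: n => [|n IH].
    rewrite (_ : (fun x => _) = (fun x => 0 * q x)); first exact: V_scale.
    by apply/funext => x; rewrite /series /= big_geq.
  under eq_fun do rewrite /series /= big_nat_recr//= mulrDl.
  apply: V_add => //.
  rewrite (_ : (fun x => _) = (fun x =>
    ((odd n)%:R * (-1) ^+ n.-1./2 / n`!%:R) * ((c * X x) ^+ n * q x))).
    exact: V_scale.
  by apply/funext => x; rewrite /sin_coeff /=; ring.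
apply: (l2_closure_dominated V_measurable
   (g_ := fun n x => series (sin_coeff (c * X x)) n * q x)
   (h := fun x => expR `|c * X x| * `|q x|)).
- by move=> n; apply: sub_l2_closure => //; exact: Vser.
- by apply: measurable_funM => //; exact: V_measurable.
- apply: measurable_funM; last exact: (measurableT_comp _ (V_measurable Vq)).
  by apply: measurableT_comp => //; exact: measurableT_comp.
- have := expX _ Vq; congr (_ < _)%E; apply: eq_integral => x _.
  by rewrite !exprMn -(normrX _ (q x)) (ger0_norm (sqr_ge0 _)).
- by move=> n x; rewrite normrM ler_wpM2r// norm_series_sin_coeff.
- move=> x; apply: cvgM; last exact: cvg_cst.
  by rewrite sin.unlock; exact: is_cvg_series_sin_coeff.
Qed.

(** The sets [a < sin (b X)] are multiplier sets, so every [sin (b X)] is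
    measurable for the sigma-algebra of multiplier sets, and [X] is a pointwise
    limit of multiples of such functions. *)
Lemma measurable_fun_multiplier_set (X : T -> R) (c : R) : 0 < c ->
    (forall b, 0 < b <= c -> multiplier mu V (fun x => sin (b * X x))) ->
  @measurable_fun _ _ (g_sigma_algebraType (multiplier_set mu V)) R setT X.
Proof.
move=> c0 mX.
have SE : <<s multiplier_set mu V >> = multiplier_set mu V.
  by apply: sigma_algebra_id; exact: multiplier_set_sigma_algebra.
apply: (@measurable_fun_cvg _ (g_sigma_algebraType (multiplier_set mu V)) R setT
    (fun n x => (c / n.+1%:R)^-1 * sin (c / n.+1%:R * X x)) X).
  move=> n; apply: measurable_funM; first exact: measurable_cst.
  apply: measurable_fun_gt => a; rewrite /measurable /= SE.
  apply: multiplier_gt => //; apply: mX.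
  by rewrite divr_gt0//= ler_pdivrMr// ler_pMr// ler1n.
by move=> x _; exact: sin_dilation_cvg.
Qed.

Lemma l2_closureZ a g : l2_closure mu V g -> l2_closure mu V (fun x => a * g x).
Proof.
apply: (@l2_closureM _ _ _ _ _ _ `|a| (cst a)) => // q Vq.
by apply: sub_l2_closure => //; exact: V_scale.
Qed.

Hypothesis V1 : V (cst 1).
Hypothesis measurable_multiplier : forall B : set T, measurable B ->
  multiplier_set mu V B.

Import HBNNSimple.

Lemma l2_closure_nnsfun (h : {nnsfun T >-> R}) : l2_closure mu V h.
Proof.
have -> : (h : T -> R) = (fun x => h x * cst 1 x).
  by apply/funext => x; rewrite mulr1.
suff [_ _] : multiplier mu V h by exact.
have -> : (h : T -> R) = _ := funext (fimfunEord h).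
apply: multiplier_sum => // i; apply: multiplierZ => //.
exact: measurable_multiplier.
Qed.

(** The simple functions increasing to [g] are dominated by [g] itself. *)
Lemma l2_closure_ge0 g : measurable_fun setT g -> (forall x, 0 <= g x) ->
  (\int[mu]_x (g x ^+ 2)%:E < +oo)%E -> l2_closure mu V g.
Proof.
move=> mg g0 goo.
have mEg : measurable_fun setT (EFin \o g) by exact/measurable_EFinP.
pose h := nnsfun_approx measurableT mEg.
apply: (l2_closure_dominated V_measurable (g_ := fun n => h n) (h := g)) => //.
- by move=> n; exact: l2_closure_nnsfun.
- move=> n x; rewrite ger0_norm// -lee_fin /h nnsfun_approxE.
  by apply: (@le_approx _ _ _ _ (EFin \o g)) => // y _; rewrite /= lee_fin.
- move=> x; have := @cvg_nnsfun_approx _ _ _ _ measurableT _ mEg _ x Logic.I.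
  by move=> /(_ (fun y _ => g0 y)) /fine_cvg.
Qed.

(** Splitting [g] into [(|g| + g) / 2] and [(|g| - g) / 2] reduces to the
    nonnegative case. *)
Lemma l2_closure_square_integrable g : measurable_fun setT g ->
  (\int[mu]_x (g x ^+ 2)%:E < +oo)%E -> l2_closure mu V g.
Proof.
move=> mg goo.
have mn : measurable_fun setT (fun x => `|g x|) by exact: measurableT_comp.
have pos (h : T -> R) : measurable_fun setT h ->
    (forall x, 0 <= h x <= `|g x|) -> l2_closure mu V h.
  move=> mh hg; apply: l2_closure_ge0 => //.
    by move=> x; have /andP[] := hg x.
  apply: le_lt_trans goo; apply: ge0_le_integral => //.
  - by move=> x _; rewrite lee_fin sqr_ge0.
  - exact: measurable_sqr_EFin.
  - exact: measurable_sqr_EFin.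
  - move=> x _; rewrite lee_fin -(ger0_norm (sqr_ge0 (g x))) normrX.
    by have /andP[h0 hx] := hg x; rewrite lerXn2r.
have -> : g = (fun x => 2^-1 * (`|g x| + g x) + (-1) * (2^-1 * (`|g x| - g x))).
  by apply/funext => x; lra.
apply: l2_closureD => //; last apply: l2_closureZ => //.
- apply: pos => [|x].
    by apply: measurable_funM => //; exact: measurable_funD.
  by have := ler_norm (g x); have := ler_norm (- g x); rewrite normrN; lra.
- apply: pos => [|x].
    by apply: measurable_funM => //; exact: measurable_funB.
  by have := ler_norm (g x); have := ler_norm (- g x); rewrite normrN; lra.
Qed.

End density.

(** * Polynomial functions and their density *)

Section polynomial_functions.
Context (R : realType) (N : nat).
Implicit Types (j k : mindex N) (q r : 'rV[R]_N -> R).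

(** Lists of terms, rather than coefficient functions on a list of exponents,
    make sums and products of polynomials immediate. *)
Definition polyfun : set ('rV[R]_N -> R) :=
  [set q | exists s : seq (R * mindex N),
    q = fun x => \sum_(t <- s) t.1 * monom t.2 x].

Lemma measurable_monom j : measurable_fun setT (@monom R N j).
Proof.
apply: measurable_prod => i _; apply: measurable_funX.
exact: measurable_coord_rV.
Qed.

Lemma monomM j k (x : 'rV[R]_N) :
  monom j x * monom k x = monom [ffun i => j i + k i]%N x.
Proof.
rewrite /monom -big_split /=; apply: eq_bigr => i _.
by rewrite ffunE exprD.
Qed.

Lemma polyfun_monom j : polyfun (@monom R N j).
Proof. by exists [:: (1, j)]; apply/funext => x; rewrite big_seq1 mul1r. Qed.

Lemma polyfunD q r : polyfun q -> polyfun r -> polyfun (fun x => q x + r x).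
Proof.
by move=> [s ->] [t ->]; exists (s ++ t); apply/funext => x; rewrite big_cat.
Qed.

Lemma polyfunZ a q : polyfun q -> polyfun (fun x => a * q x).
Proof.
move=> [s ->]; exists [seq (a * t.1, t.2) | t <- s]; apply/funext => x.
by rewrite big_map mulr_sumr; apply: eq_bigr => t _; rewrite mulrA.
Qed.

Lemma polyfun_sum (I : Type) (s : seq I) (F : I -> 'rV[R]_N -> R) :
  (forall i, polyfun (F i)) -> polyfun (fun x => \sum_(i <- s) F i x).
Proof.
move=> pF; elim: s => [|i s IH].
  by exists [::]; apply/funext => x; rewrite !big_nil.
by under eq_fun do rewrite big_cons; exact: polyfunD.
Qed.

Lemma polyfunM q r : polyfun q -> polyfun r -> polyfun (fun x => q x * r x).
Proof.
move=> [s ->] [t ->].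
rewrite (_ : (fun x => _) = (fun x => \sum_(u <- s) \sum_(v <- t)
    u.1 * (v.1 * monom [ffun i => u.2 i + v.2 i]%N x))).
  do 2 apply: polyfun_sum => ?; do 2 apply: polyfunZ.
  exact: polyfun_monom.
apply/funext => x; rewrite mulr_suml; apply: eq_bigr => u _.
rewrite mulr_sumr; apply: eq_bigr => v _.
by rewrite -monomM; ring.
Qed.

Lemma polyfun1 : polyfun (cst 1).
Proof.
have := polyfun_monom [ffun=> 0%N]; congr polyfun; apply/funext => x.
by rewrite /monom big1// => i _; rewrite ffunE expr0.
Qed.

Lemma polyfun_coord (i : 'I_N) : polyfun (fun x => x ord0 i).
Proof.
have := polyfun_monom [ffun k => (k == i)%N : nat]; congr polyfun.
apply/funext => x; rewrite /monom (bigD1 i)//= ffunE eqxx expr1 big1 ?mulr1//.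
by move=> k /negPf ki; rewrite ffunE ki expr0.
Qed.

Lemma polyfunX q n : polyfun q -> polyfun (fun x => q x ^+ n).
Proof.
move=> pq; elim: n => [|n IH]; first exact: polyfun1.
by under eq_fun do rewrite exprS; exact: polyfunM.
Qed.

Lemma measurable_polyfun q : polyfun q -> measurable_fun setT q.
Proof.
move=> [s ->]; apply: measurable_sum => t; apply: measurable_funM => //.
exact: measurable_monom.
Qed.

Lemma poly_space_polyfun m q : poly_space m q -> polyfun q.
Proof.
move=> [s [c [_ ->]]]; apply: polyfun_sum => j; apply: polyfunZ.
exact: polyfun_monom.
Qed.

End polynomial_functions.

Section polyfun_density.
Context (R : realType) (N : nat) (mu : {measure set 'rV[R]_N -> \bar R}).
Hypothesis moments : forall j : mindex N, mu.-integrable setT (EFin \o monom j).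
Hypothesis exp_moments : forall i : 'I_N, exists2 c : R, 0 < c &
  (\int[mu]_x (expR (c * `|x ord0 i|))%:E < +oo)%E.

Lemma integrable_polyfun q : polyfun q -> mu.-integrable setT (EFin \o q).
Proof.
move=> [s ->]; rewrite (_ : _ \o _ = fun x =>
    \sum_(t <- s) (t.1%:E * (monom t.2 x)%:E))%E.
  by apply: integrable_sum => // t _; apply: integrableZl => //; exact: moments.
by apply/funext => x /=; rewrite -sumEFin.
Qed.

Lemma polyfun_even_moment q n : ~~ odd n -> polyfun q ->
  (\int[mu]_x (q x ^+ n)%:E < +oo)%E.
Proof.
move=> n_even /(@polyfunX _ _ _ n)/integrable_polyfun/integrableP[_].
congr (_ < _)%E; apply: eq_integral => x _ /=.
by rewrite ger0_norm// exprn_even_ge0.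
Qed.

Lemma polyfun_sqr q : polyfun q -> (\int[mu]_x (q x ^+ 2)%:E < +oo)%E.
Proof. exact: polyfun_even_moment. Qed.

(** The majorant is square integrable because
    [(expR (b |x_i|) q)^2 <= expR (4 b |x_i|) + q^4]. *)
Lemma multiplier_sin_coord (i : 'I_N) (c b : R) :
    (\int[mu]_x (expR (c * `|x ord0 i|))%:E < +oo)%E -> 0 < b <= c / 4 ->
  multiplier mu (@polyfun R N) (fun x => sin (b * x ord0 i)).
Proof.
move=> coo /andP[b0 bc].
have mX := @measurable_coord_rV R N i.
apply: multiplier_sin => //.
- exact: measurable_polyfun.
- exact: polyfunD.
- exact: polyfunZ.
- by move=> q; apply: polyfunM; exact: polyfun_coord.
move=> q pq; have mq := measurable_polyfun pq.
have mexp k :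
    measurable_fun setT (fun x : 'rV[R]_N => (expR (k * `|x ord0 i|))%:E).
  apply/measurable_EFinP; apply: measurableT_comp => //.
  by apply: measurable_funM => //; exact: measurableT_comp.
have mq4 : measurable_fun setT (fun x => (q x ^+ 4)%:E).
  by apply/measurable_EFinP; exact: measurable_funX.
apply: (@le_lt_trans _ _
    (\int[mu]_x ((expR (c * `|x ord0 i|))%:E + (q x ^+ 4)%:E)))%E; last first.
  rewrite ge0_integralD//.
  - by apply: lte_add_pinfty => //; exact: polyfun_even_moment.
  - by move=> x _; rewrite lee_fin exprn_even_ge0.
apply: ge0_le_integral => //.
- by move=> x _; rewrite lee_fin sqr_ge0.
- apply: measurable_sqr_EFin; apply: measurable_funM => //.
  apply: measurableT_comp => //; apply: measurableT_comp => //.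
  exact: measurable_funM.
- exact: emeasurable_funD.
move=> x _; rewrite -EFinD lee_fin normrM (gtr0_norm b0).
set z := `|x ord0 i|; have z0 : 0 <= z by exact: normr_ge0.
have e4 : expR (b * z) ^+ 4 <= expR (c * z).
  by rewrite -expRM_natl ler_expR; nra.
apply: le_trans (lerD e4 (lexx _)).
have := sqr_ge0 (expR (b * z) ^+ 2 - q x ^+ 2).
have := sqr_ge0 (expR (b * z) ^+ 2); have := sqr_ge0 (q x ^+ 2).
by rewrite exprMn -[4%N]/(2 * 2)%N !exprM; nra.
Qed.

(** Measurability of the identity with respect to the sigma-algebra of
    multiplier sets can be tested on the coordinates. *)
Lemma borel_multiplier B : measurable B -> multiplier_set mu (@polyfun R N) B.
Proof.
move=> mB; set S := multiplier_set mu _.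
have pD := @polyfunD R N; have pZ := @polyfunZ R N.
have pm := @measurable_polyfun R N.
have p2 := polyfun_sqr.
have SE : <<s S >> = S.
  by apply: sigma_algebra_id; exact: multiplier_set_sigma_algebra.
have mid : @measurable_fun _ _ (g_sigma_algebraType S) 'rV[R]_N setT id.
  apply: measurable_rV => i; have [c c0 coo] := exp_moments i.
  apply: (measurable_fun_multiplier_set pm pD pZ p2 (c := c / 4)).
    by rewrite divr_gt0.
  by move=> b; exact: multiplier_sin_coord.
by have := mid measurableT _ mB; rewrite setTI preimage_id /measurable /= SE.
Qed.

Lemma polyfun_dense (y : 'rV[R]_N -> R) : measurable_fun setT y ->
  (\int[mu]_x (y x ^+ 2)%:E < +oo)%E -> l2_closure mu (@polyfun R N) y.
Proof.
apply: l2_closure_square_integrable.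
- exact: measurable_polyfun.
- exact: polyfunD.
- exact: polyfunZ.
- exact: polyfun1.
- exact: borel_multiplier.
Qed.

End polyfun_density.

(** * Norms on row vectors *)

Lemma measurable_continuous_rV (R : realType) N (g : 'rV[R]_N -> R) :
  continuous g -> measurable_fun setT g.
Proof.
move=> cg; apply: measurable_fun_gt => a; apply: open_measurable_rV.
apply: (open_comp (D := [set z | a < z])); last exact: open_gt.
by move=> x _; exact: cg.
Qed.

Lemma coord_le_norm (R : realType) N (x : 'rV[R]_N) i : `|x ord0 i| <= `|x|.
Proof.
rewrite [leRHS]/Num.norm /= mx_normrE.
by apply/bigmax_geP; right; exists (ord0, i).
Qed.

Section norms.
Context (R : realType) (N : nat) (nrm : 'rV[R]_N -> R).
Hypothesis hnrm : is_norm nrm.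
Implicit Types x y : 'rV[R]_N.

Lemma is_normN x : nrm (- x) = nrm x.
Proof. by case: hnrm => _ nZ _; rewrite -scaleN1r nZ normrN1 mul1r. Qed.

Lemma is_norm0 : nrm 0 = 0.
Proof. by case: hnrm => _ nZ _; rewrite -(scale0r 0) nZ normr0 mul0r. Qed.

Lemma is_norm_ge0 x : 0 <= nrm x.
Proof.
case: hnrm => nD _ _; have := nD x (- x).
by rewrite subrr is_norm0 is_normN; lra.
Qed.

Lemma is_norm_le : exists2 K, 0 < K & forall x, nrm x <= K * `|x|.
Proof.
case: hnrm => nD nZ _; pose K := \sum_i nrm (delta_mx ord0 i) + 1.
have K0 : 0 < K by rewrite ltr_wpDl// sumr_ge0// => i _; exact: is_norm_ge0.
exists K => // x.
apply: (@le_trans _ _ (\sum_i nrm (x ord0 i *: delta_mx ord0 i))).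
  rewrite {1}(row_sum_delta x); elim/big_ind2 : _ => [|u a v b ua vb|//].
    by rewrite is_norm0.
  by apply: le_trans (nD _ _) _; exact: lerD.
rewrite /K mulrDl mul1r ler_wpDr// mulr_suml; apply: ler_sum => i _.
by rewrite nZ mulrC ler_wpM2l ?is_norm_ge0 ?coord_le_norm.
Qed.

Lemma is_norm_dist x y : `|nrm x - nrm y| <= nrm (x - y).
Proof.
case: hnrm => nD _ _; rewrite ler_norml; apply/andP; split.
  by have := nD (y - x) x; rewrite subrK -(is_normN (x - y)) opprB; lra.
by have := nD (x - y) y; rewrite subrK; lra.
Qed.

Lemma is_norm_continuous : continuous nrm.
Proof.
have [K K0 nK] := is_norm_le; move=> x.
apply/(@cvgrPdist_lt _ _ _ (nbhs x) (nbhs_filter x)) => e e0.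
have eK : 0 < e / K by rewrite divr_gt0.
have := nbhsx_ballx x _ eK; apply: (@filterS _ (nbhs x)) => t.
rewrite -ball_normE /= => xt; apply: (le_lt_trans (is_norm_dist _ _)).
by apply: (le_lt_trans (nK _)); rewrite mulrC -ltr_pdivlMr.
Qed.

(** A norm has a positive minimum on the unit sphere of the sup norm, which is
    compact; by homogeneity it dominates the sup norm. *)
Lemma is_norm_coord (i : 'I_N) :
  exists2 m : R, 0 < m & forall x, m * `|x ord0 i| <= nrm x.
Proof.
case: (hnrm) => _ nZ n0; pose S := [set x : 'rV[R]_N | `|x| = 1].
have S0 : S !=set0.
  exists (const_mx 1); rewrite /S /= /Num.norm /= mx_normrE.
  apply/eqP; rewrite eq_le; apply/andP; split.
    by apply/bigmax_leP; split => // k _; rewrite mxE normr1.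
  by apply/bigmax_geP; right; exists (ord0, i) => //; rewrite mxE normr1.
have cS : compact S.
  apply: bounded_closed_compact.
    by exists 1; split => // z z1 x /= ->; exact: ltW.
  rewrite (_ : S = Num.norm @^-1` [set 1])//.
  apply: (preimage_closed (fun x _ => @norm_continuous _ _ x)).
  exact: closed_eq.
have [c /set_mem cS1 cmin] :=
  EVT_min_rV S0 cS (continuous_subspaceT is_norm_continuous).
have c0 : 0 < nrm c.
  rewrite lt_neqAle is_norm_ge0 andbT eq_sym; apply/negP => /eqP /n0 cE.
  by move: cS1; rewrite /S /= cE normr0 => /eqP; rewrite eq_sym oner_eq0.
exists (nrm c) => // x; apply: (@le_trans _ _ (nrm c * `|x|)).
  by rewrite ler_wpM2l ?is_norm_ge0 ?coord_le_norm.
have [->|x0] := eqVneq x 0; first by rewrite normr0 mulr0 is_norm_ge0.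
have xp : 0 < `|x| by rewrite normr_gt0.
have /cmin : `|x|^-1 *: x \in S.
  by apply/mem_set; rewrite /S /= normrZ normfV normr_id mulVf// gt_eqF.
by rewrite nZ normfV normr_id ler_pdivlMl// mulrC.
Qed.

End norms.

(** * Integrals with respect to the law of the input *)

Section density_integral.
Context d (T : measurableType d) (R : realType).
Local Open Scope ereal_scope.

(** By uniqueness, [f] is almost everywhere the Radon-Nikodym derivative. *)
Lemma ge0_integral_density (nu : {finite_measure set T -> \bar R})
    (la : {sigma_finite_measure set T -> \bar R})
    (f : T -> R) (g : T -> \bar R) :
    measurable_fun setT f ->
    (forall B, measurable B -> nu B = \int[la]_(x in B) (f x)%:E) ->
    measurable_fun setT g -> (forall x, 0 <= g x) ->
  \int[nu]_x g x = \int[la]_x (g x * (f x)%:E).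
Proof.
move=> mf nuE mg g0.
have mEf : measurable_fun setT (EFin \o f) by exact/measurable_EFinP.
have nula : nu `<< la.
  apply/null_content_dominatesP => B mB laB0.
  by rewrite nuE// null_set_integral//; exact: measurable_funTS.
rewrite -(Radon_Nikodym_SigmaFinite.change_of_variables nula)//.
have iRN := Radon_Nikodym_SigmaFinite.f_integrable nula.
apply: ae_eq_integral => //.
- by apply: emeasurable_funM => //; exact: measurable_int iRN.
- exact: emeasurable_funM.
have : ae_eq la setT (Radon_Nikodym_SigmaFinite.f nu la) (EFin \o f).
  apply: integral_ae_eq => // E _ mE.
  by rewrite -Radon_Nikodym_SigmaFinite.f_integral// nuE.
by apply: filterS => x /= fx Dx; rewrite fx.
Qed.

End density_integral.

Section change_of_variables.
Context (R : realType) (d : measure_display) (T : measurableType d)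
  (P : probability T R) (N : nat) (A : set 'rV[R]_N)
  (X : {RV P >-> 'rV[R]_N}) (f nrm : 'rV[R]_N -> R).
Hypothesis hX : input_assumption A X f nrm.
Let la := lebesgue_rV R N.
Let mA : measurable A := input_borel hX.

(** On [A], preimages of open sets are traces of open sets; off [A], the density
    vanishes. *)
Lemma measurable_density : measurable_fun setT f.
Proof.
have f0 := density_ge0 hX.
rewrite -(setvU A); apply/measurable_funU => //; first exact: measurableC.
split.
  apply: (eq_measurable_fun (cst (0 : R))) => [x|]; last exact: measurable_cst.
  by rewrite inE => /(density_out hX).
apply: (measurability _ (RGenOpens.measurableE R)).
move=> _ [_ [a [b ->]] <-].
have oab : open (`]a, b[%classic : set R) by exact: interval_open.
have /continuousP/(_ _ oab)/open_subspaceP [V oV VA] := density_continuous hX.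
rewrite setIC -VA.
by apply: measurableI => //; exact: open_measurable_rV.
Qed.

Lemma ge0_integral_input (g : 'rV[R]_N -> \bar R) :
    measurable_fun setT g -> (forall x, (0 <= g x)%E) ->
  (\int[distribution P X]_x g x = \int[la]_(x in A) (g x * (f x)%:E))%E.
Proof.
move=> mg g0.
rewrite (ge0_integral_density measurable_density (density_law hX))//.
rewrite [RHS]integral_mkcond; apply: eq_integral => x _.
rewrite patchE; case: ifPn => //; rewrite notin_setE => /(density_out hX) ->.
by rewrite mule0.
Qed.

Lemma measurable_fun_input (h : 'rV[R]_N -> R) : measurable_fun A h ->
  measurable_fun setT (h \o X).
Proof.
move=> mh; rewrite (_ : _ \o _ = (h \_ A) \o X).
  by apply: measurableT_comp => //; exact/(measurable_restrictT _ mA).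
by apply/funext => w /=; rewrite patchE mem_set//; exact: (input_range hX).
Qed.

(** Absolute value, positive part and negative part are positively homogeneous,
    so each of them commutes with the multiplication by the density. *)
Lemma integral_input (h : 'rV[R]_N -> R) : measurable_fun A h ->
    P.-integrable setT (EFin \o (h \o X)) ->
  la.-integrable A (fun x => (h x * f x)%:E) /\
  (\int[P]_w (h (X w))%:E = \int[la]_(x in A) (h x * f x)%:E)%E.
Proof.
move=> mh /integrableP[mhX hoo].
have f0 := density_ge0 hX.
have mf : measurable_fun A f by exact: measurable_funTS measurable_density.
pose h' := h \_ A.
have mh' : measurable_fun setT h' by exact/(measurable_restrictT _ mA).
have hX' w : h' (X w) = h (X w).
  by rewrite /h' patchE mem_set//; exact: (input_range hX).
have hA x : A x -> h' x = h x by move=> Ax; rewrite /h' patchE mem_set.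
have transfer (g : R -> R) : measurable_fun setT g -> (forall x, 0 <= g x) ->
    (forall x r, 0 <= r -> g (x * r) = g x * r) ->
    (\int[P]_w (g (h (X w)))%:E = \int[la]_(x in A) (g (h x * f x))%:E)%E.
  move=> mg g0 gM.
  have mgh : measurable_fun setT (fun x => (g (h' x))%:E).
    by apply/measurable_EFinP; exact: measurableT_comp.
  transitivity (\int[P]_w ((fun x => (g (h' x))%:E) \o X) w)%E.
    by apply: eq_integral => w _; rewrite /= hX'.
  rewrite -ge0_integral_distribution//; last by move=> x; rewrite lee_fin.
  rewrite ge0_integral_input//; last by move=> x; rewrite lee_fin.
  by apply: eq_integral => x /set_mem Ax; rewrite /= hA// gM.
have mhf : measurable_fun A (fun x => (h x * f x)%:E).
  by apply/measurable_EFinP; exact: measurable_funM.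
split.
  apply/integrableP; split => //.
  rewrite -[ltLHS](transfer Num.norm)//.
  by move=> x r r0; rewrite normrM (ger0_norm r0).
rewrite integralE [RHS]integralE; congr (_ - _)%E.
- rewrite (eq_integral (fun w => (Num.max (h (X w)) 0)%:E)); last first.
    by move=> w _; rewrite funeposE -EFin_max.
  rewrite (transfer (fun z => Num.max z 0))//; last 3 first.
  + exact: measurable_maxr.
  + by move=> x; rewrite le_max lexx orbT.
  + by move=> x r r0; rewrite maxr_pMl// mul0r.
  by apply: eq_integral => x _; rewrite funeposE -EFin_max.
- rewrite (eq_integral (fun w => (Num.max (- h (X w)) 0)%:E)); last first.
    by move=> w _; rewrite funenegE -EFinN -EFin_max.
  rewrite (transfer (fun z => Num.max (- z) 0))//; last 3 first.
  + exact: measurable_maxr.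
  + by move=> x; rewrite le_max lexx orbT.
  + by move=> x r r0; rewrite maxr_pMl// mul0r mulNr.
  by apply: eq_integral => x _; rewrite funenegE -EFinN -EFin_max.
Qed.

Lemma input_moments j : (distribution P X).-integrable setT (EFin \o monom j).
Proof.
have mm : measurable_fun setT (EFin \o @monom R N j).
  by apply/measurable_EFinP; exact: measurable_monom.
apply/integrableP; split => //.
rewrite ge0_integral_input//; last exact: measurableT_comp.
exact: (finite_moments hX).
Qed.

Hypothesis hnrm : is_norm nrm.

Lemma input_exp_moments (i : 'I_N) : exists2 c : R, 0 < c &
  (\int[distribution P X]_x (expR (c * `|x ord0 i|))%:E < +oo)%E.
Proof.
have mexp c :
    measurable_fun setT (fun x : 'rV[R]_N => (expR (c * `|x ord0 i|))%:E).
  apply/measurable_EFinP; apply: measurableT_comp => //.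
  apply: measurable_funM => //; apply: measurableT_comp => //.
  exact: measurable_coord_rV.
case: (compact_or_exp_integrable hX) => [[K [cK PK1]]|[a [a0 aoo]]].
- have [M [_ KM]] := compact_bounded cK.
  have {}KM x : K x -> `|x| <= `|M| + 1.
    by apply: KM; rewrite (le_lt_trans (ler_norm _))// ltrDl.
  exists 1; rewrite ?ltr01//.
  have mK : measurable K.
    rewrite -(setCK K); apply: measurableC; apply: open_measurable_rV.
    by apply: closed_openC; apply: compact_closed => //; exact: norm_hausdorff.
  have KC0 : distribution P X (~` K) = 0%E.
    transitivity (1 - 1 : \bar R)%E; last by rewrite subee.
    by rewrite probability_setC//; congr (_ - _)%E.
  apply: (@le_lt_trans _ _ (\int[distribution P X]_x (expR (`|M| + 1))%:E)%E).
    apply: ae_ge0_le_integral => //.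
    exists (~` K); split => //; first exact: measurableC.
    move=> x /= nle Kx; apply: nle => _.
    by rewrite lee_fin ler_expR mul1r (le_trans (coord_le_norm _ _))// KM.
  rewrite integral_cst// [X in (_ * X)%E](_ : _ = 1%E) ?mule1 ?ltry//.
  exact: probability_setT.
- have [m m0 mle] := is_norm_coord hnrm i.
  have mnrm := measurable_continuous_rV (is_norm_continuous hnrm).
  exists (a * m); first exact: mulr_gt0.
  apply: (@le_lt_trans _ _ (\int[distribution P X]_x (expR (a * nrm x))%:E)%E).
    apply: ge0_le_integral => //.
    + apply/measurable_EFinP; apply: measurableT_comp => //.
      exact: measurable_funM.
    + by move=> x _; rewrite lee_fin ler_expR -mulrA ler_wpM2l// ltW.
  rewrite ge0_integral_input//.
  apply/measurable_EFinP; apply: measurableT_comp => //.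
  exact: measurable_funM.
Qed.

Lemma polyfun_dense_input (y : 'rV[R]_N -> R) : measurable_fun A y ->
    ('E_P[fun w => (y (X w) ^+ 2)%R] < +oo)%E -> forall e : R, 0 < e ->
  exists2 q, polyfun q &
    ('E_P[fun w => ((y (X w) - q (X w)) ^+ 2)%R] < e%:E)%E.
Proof.
move=> my yoo e e0; pose y' := y \_ A.
have my' : measurable_fun setT y' by exact/(measurable_restrictT _ mA).
have yX w : y' (X w) = y (X w).
  by rewrite /y' patchE mem_set//; exact: (input_range hX).
have y'oo : (\int[distribution P X]_x (y' x ^+ 2)%:E < +oo)%E.
  rewrite ge0_integral_distribution//; last 2 first.
  - exact: measurable_sqr_EFin.
  - by move=> x; rewrite lee_fin sqr_ge0.
  move: yoo; rewrite unlock; congr (_ < _)%E.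
  by apply: eq_integral => w _; rewrite /= yX.
have [_ /(_ e e0)[q pq]] :=
  polyfun_dense input_moments input_exp_moments my' y'oo.
have mq := measurable_polyfun pq.
rewrite /sqdist ge0_integral_distribution//; last 2 first.
- by apply: measurable_sqr_EFin; exact: measurable_funB.
- by move=> x; rewrite lee_fin sqr_ge0.
move=> lte; exists q => //; rewrite unlock; move: lte; congr (_ < _)%E.
by apply: eq_integral => w _; rewrite /= yX.
Qed.

End change_of_variables.

(** * The inner product of square-integrable functions *)

Section inner_product.
Context d (T : measurableType d) (R : realType).
Variable mu : {measure set T -> \bar R}.
Implicit Types (u v : T -> R).
Local Notation L2 := (Lfun mu 2%:E).

Lemma Lfun2P u : (u \in L2) <->
  measurable_fun setT u /\ (\int[mu]_x (u x ^+ 2)%:E < +oo)%E.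
Proof.
split=> [u2|[mu_ u2]].
  split; first by move: u2; rewrite inE => /andP[/[!inE]].
  have /integrableP[_] := Lfun2_integrable_sqr u2.
  congr (_ < _)%E; apply: eq_integral => x _ /=.
  by rewrite ger0_norm// sqr_ge0.
rewrite inE; apply/andP; split; rewrite inE//=.
rewrite /finite_norm unlock; apply: poweR_lty; move: u2; congr (_ < _)%E.
apply: eq_integral => x _ /=; rewrite powR_mulrn//.
by rewrite -normrX ger0_norm// sqr_ge0.
Qed.

Lemma Lfun2_measurable u : u \in L2 -> measurable_fun setT u.
Proof. by case/Lfun2P. Qed.

Lemma Lfun2_integrableM u v : u \in L2 -> v \in L2 ->
  mu.-integrable setT (fun x => (u x * v x)%:E).
Proof. by move=> u2 v2; apply/Lfun1_integrable; exact: Lfun2_mul_Lfun1. Qed.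

Lemma Lfun2D u v : u \in L2 -> v \in L2 -> (fun x => u x + v x) \in L2.
Proof.
move=> u2 v2; have p1 : (1 <= 2%:E :> \bar R)%E by rewrite lee_fin ler1n.
exact: (Lfun_addr_closed mu p1).2.
Qed.

Lemma Lfun2Z a u : u \in L2 -> (fun x => a * u x) \in L2.
Proof.
move=> u2; have -> : (fun x => a * u x) = a \o* u.
  by apply/funext => x /=; rewrite mulrC.
by apply: Lfun_scale => //; rewrite ler1n.
Qed.

Lemma Lfun2_0 : (fun=> 0) \in L2.
Proof.
apply/Lfun2P; split => //; rewrite integral0_eq ?ltry// => x _.
by rewrite expr0n.
Qed.

Lemma Lfun2B u v : u \in L2 -> v \in L2 -> (fun x => u x - v x) \in L2.
Proof.
move=> u2 v2; under eq_fun do rewrite -mulN1r.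
by apply: Lfun2D => //; exact: Lfun2Z.
Qed.

Lemma Lfun2_sum (I : Type) (s : seq I) (F : I -> T -> R) :
  (forall i, F i \in L2) -> (fun x => \sum_(i <- s) F i x) \in L2.
Proof.
move=> F2; elim: s => [|i s IH].
  by under eq_fun do rewrite big_nil; exact: Lfun2_0.
by under eq_fun do rewrite big_cons; exact: Lfun2D.
Qed.

Definition inner u v : R := \int[mu]_x (u x * v x).

Lemma innerC u v : inner u v = inner v u.
Proof. by apply: eq_Rintegral => x _; rewrite mulrC. Qed.

Lemma innerZr a u v : u \in L2 -> v \in L2 ->
  inner u (fun x => a * v x) = a * inner u v.
Proof.
move=> u2 v2; rewrite -RintegralZl//; last exact: Lfun2_integrableM.
by apply: eq_Rintegral => x _; rewrite mulrCA.
Qed.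

Lemma innerDr u v v' : u \in L2 -> v \in L2 -> v' \in L2 ->
  inner u (fun x => v x + v' x) = inner u v + inner u v'.
Proof.
move=> u2 v2 v'2; rewrite -RintegralD//; last 2 first.
- exact: Lfun2_integrableM.
- exact: Lfun2_integrableM.
by apply: eq_Rintegral => x _; rewrite mulrDr.
Qed.

Lemma innerBr u v v' : u \in L2 -> v \in L2 -> v' \in L2 ->
  inner u (fun x => v x - v' x) = inner u v - inner u v'.
Proof.
move=> u2 v2 v'2; under [in LHS]eq_fun do rewrite -mulN1r.
by rewrite innerDr ?innerZr ?Lfun2Z// mulN1r.
Qed.

Lemma inner_sumr (I : Type) (s : seq I) (a : I -> R) u (F : I -> T -> R) :
    u \in L2 -> (forall i, F i \in L2) ->
  inner u (fun x => \sum_(i <- s) a i * F i x) =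
  \sum_(i <- s) a i * inner u (F i).
Proof.
move=> u2 F2; elim: s => [|i s IH].
  rewrite big_nil /inner; under eq_Rintegral do rewrite big_nil mulr0.
  by rewrite /Rintegral integral0.
under [in LHS]eq_fun do rewrite big_cons.
rewrite innerDr ?innerZr ?IH ?big_cons// ?Lfun2Z//.
by apply: Lfun2_sum => k; exact: Lfun2Z.
Qed.

Lemma inner_suml (I : Type) (s : seq I) (a : I -> R) u (F : I -> T -> R) :
    u \in L2 -> (forall i, F i \in L2) ->
  inner (fun x => \sum_(i <- s) a i * F i x) u =
  \sum_(i <- s) a i * inner (F i) u.
Proof.
move=> u2 F2; rewrite innerC inner_sumr//; apply: eq_bigr => i _.
by rewrite innerC.
Qed.

Lemma pythagoras_le u v : u \in L2 -> v \in L2 -> inner u v = 0 ->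
  (\int[mu]_x (u x ^+ 2)%:E <= \int[mu]_x ((u x + v x) ^+ 2)%:E)%E.
Proof.
move=> u2 v2 uv0; have uv2 := Lfun2D u2 v2.
have sqrE w : w \in L2 -> (\int[mu]_x (w x ^+ 2)%:E = (inner w w)%:E)%E.
  move=> w2; rewrite /inner /Rintegral fineK//.
  exact/integrable_fin_num/Lfun2_integrableM.
rewrite !sqrE// lee_fin innerDr// ![inner (fun x => u x + v x) _]innerC.
rewrite !innerDr// [inner v u]innerC uv0 add0r addr0 lerDl.
by apply: Rintegral_ge0 => x _; rewrite -expr2 sqr_ge0.
Qed.

End inner_product.

(** * Orthonormal polynomials and the best approximation *)

Section expansion.
Context (R : realType) (d : measure_display) (T : measurableType d)
  (P : probability T R) (N : nat) (A : set 'rV[R]_N)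
  (X : {RV P >-> 'rV[R]_N}) (f nrm : 'rV[R]_N -> R)
  (le : rel (mindex N)) (idx : forall l : nat, 'I_(nmonom N l) -> mindex N)
  (p : mindex N -> 'rV[R]_N -> R) (W : forall l : nat, 'M[R]_(nmonom N l)).
Hypothesis hX : input_assumption A X f nrm.
Hypothesis hidx : monomial_listing le idx.
Hypothesis hp : orthogonal_polynomials A f idx p.
Hypothesis hW : whitening P X idx p W.
Local Notation L2 := (Lfun P 2%:E).
Local Notation la := (lebesgue_rV R N).
Let Psi := orthonormal_vec idx p W.
Let mA : measurable A := input_borel hX.

Lemma monomial_listing_inj l : injective (@idx l).
Proof.
have [_ _ lt_idx] := hidx l; move=> a b ab; apply: ord_inj.
by case: (ltngtP (nat_of_ord a) b) => // /lt_idx /andP[_]; rewrite ab eqxx.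
Qed.

Lemma Lfun2_polyfun q : polyfun q -> q \o X \in L2.
Proof.
move=> pq; have mq := measurable_polyfun pq; apply/Lfun2P; split.
  exact: measurableT_comp.
have := polyfun_sqr (input_moments hX) pq.
rewrite ge0_integral_distribution//; first exact: measurable_sqr_EFin.
by move=> x; rewrite lee_fin sqr_ge0.
Qed.

Lemma inner_input q r : q \o X \in L2 -> r \o X \in L2 ->
    measurable_fun A q -> measurable_fun A r ->
  inner P (q \o X) (r \o X) = \int[la]_(x in A) (q x * r x * f x).
Proof.
move=> q2 r2 mq mr.
have [||_ qr] := @integral_input _ _ _ _ _ _ _ _ _ hX (fun x => q x * r x).
- exact: measurable_funM.
- exact: Lfun2_integrableM.
by rewrite /inner /Rintegral qr.
Qed.

Lemma polyfun_orthopoly j : polyfun (p j).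
Proof. exact: poly_space_polyfun (orthopoly_deg hp j). Qed.

Let mX k := @monom R N k \o X.
Let pX l b := p (@idx l b) \o X.

Let mX2 k : mX k \in L2.
Proof. exact/Lfun2_polyfun/polyfun_monom. Qed.

Let pX2 l b : @pX l b \in L2.
Proof. exact/Lfun2_polyfun/polyfun_orthopoly. Qed.

Lemma inner_monom_orthopoly r l a b : inner P (mX (@idx r a)) (@pX l b) =
  mx_integral A f (fun x => monom_vec idx r x *m (poly_vec idx p l x)^T) a b.
Proof.
rewrite (inner_input (mX2 _) (@pX2 _ _)); last 2 first.
- by apply: measurable_funTS; exact: measurable_monom.
- apply: measurable_funTS; apply: measurable_polyfun.
  exact: polyfun_orthopoly.
by rewrite mxE; apply: eq_Rintegral => x _; rewrite !mxE big_ord1 !mxE.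
Qed.

Lemma inner_lower_monom k l b : (mabs k < l)%N -> inner P (mX k) (@pX l b) = 0.
Proof.
move=> kl; have [_ /(_ k erefl)[a <-] _] := hidx (mabs k).
by rewrite inner_monom_orthopoly (orthopoly_orth hp kl) mxE.
Qed.

Lemma moment_matrixE l a b :
  moment_matrix P X idx p l a b = inner P (@pX l a) (@pX l b).
Proof.
rewrite mxE unlock; congr fine; apply: eq_integral => w _.
by rewrite !mxE big_ord1 !mxE.
Qed.

(** As [invmx] fixes the singular matrices, a singular moment matrix would have
    to equal the invertible matrix [(W l)^T *m W l]. *)
Lemma moment_matrix_unit l : moment_matrix P X idx p l \in unitmx.
Proof.
have Wu := whitening_unit hW l.
by rewrite -unitmx_inv -(whiteningE hW) unitmx_mul unitmx_tr Wu.
Qed.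

(** The values [phi] are arbitrary so as to cover the inner products of a fixed
    function with the monomials. *)
Lemma split_top_degree l (s : seq (mindex N)) (c : mindex N -> R) :
    all (fun j => mabs j <= l)%N s ->
  exists a : 'I_(nmonom N l) -> R, forall phi : mindex N -> R,
    \sum_(j <- s) c j * phi j =
    \sum_i a i * phi (idx i) + \sum_(j <- s | (mabs j < l)%N) c j * phi j.
Proof.
move=> sl; exists (fun i => \sum_(j <- s | j == idx i) c j) => phi.
rewrite (bigID (fun j => mabs j < l)%N) /= addrC; congr (_ + _).
transitivity (\sum_(j <- s) \sum_(i < nmonom N l)
    (if j == idx i then c j * phi (idx i) else 0)); last first.
  rewrite exchange_big /=; apply: eq_bigr => i _.
  by rewrite mulr_suml -big_mkcond.
have [idx_deg idx_onto _] := hidx l.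
rewrite big_mkcond big_seq [RHS]big_seq; apply: eq_bigr => j /(allP sl) jl.
case: ifPn => [|/negPn jlt]; last first.
  rewrite big1// => i _; case: eqP => // ji.
  by rewrite ji idx_deg ltnn in jlt.
rewrite -leqNgt => lj.
have [i0 i0j] := idx_onto j (anti_leq (introT andP (conj jl lj))).
rewrite (bigD1 i0)//= i0j eqxx big1 ?addr0// => i ii0.
case: eqP => // ji; case/eqP: ii0; apply: monomial_listing_inj.
by rewrite i0j ji.
Qed.

(** The change of basis from the monomials of degree [l] to the top-degree
    parts of the orthogonal polynomials of degree [l] is invertible: multiplied
    by the matrix of the pairings of the two families, it gives the moment
    matrix. *)
Lemma leading_matrix l : exists2 B : 'M[R]_(nmonom N l), B \in unitmx &
  forall u, u \in L2 ->
    (forall k, (mabs k < l)%N -> inner P u (mX k) = 0) ->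
    forall b, inner P u (@pX l b) = \sum_a B b a * inner P u (mX (@idx l a)).
Proof.
have [idx_deg _ _] := hidx l.
have /choice[B BE] : forall b, exists a : 'I_(nmonom N l) -> R,
    forall u, u \in L2 ->
      (forall k, (mabs k < l)%N -> inner P u (mX k) = 0) ->
      inner P u (@pX l b) = \sum_i a i * inner P u (mX (@idx l i)).
  move=> b; have [s [c []]] := orthopoly_deg hp (@idx l b).
  rewrite idx_deg => sl pE; have [a aE] := split_top_degree c sl.
  exists a => u u2 u0.
  have -> : @pX l b = fun w => \sum_(j <- s) c j * mX j w.
    by apply/funext => w; rewrite /pX /= pE.
  rewrite inner_sumr// aE [X in _ + X]big1 ?addr0// => k kl.
  by rewrite u0 ?mulr0.
exists (\matrix_(b, a) B b a); last first.
  by move=> u u2 u0 b; rewrite BE//; apply: eq_bigr => a _; rewrite mxE.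
have := moment_matrix_unit l.
suff -> : moment_matrix P X idx p l = (\matrix_(b, a) B b a) *m
    mx_integral A f (fun x => monom_vec idx l x *m (poly_vec idx p l x)^T).
  by rewrite unitmx_mul => /andP[].
apply/matrixP => b b'; rewrite moment_matrixE innerC BE//; last first.
  by move=> k kl; rewrite innerC inner_lower_monom.
rewrite [RHS]mxE; apply: eq_bigr => a _.
by rewrite mxE innerC inner_monom_orthopoly.
Qed.

Lemma unitmx_cV_eq0 n (B : 'M[R]_n) (v : 'I_n -> R) : B \in unitmx ->
  (forall b, \sum_a B b a * v a = 0) -> forall a, v a = 0.
Proof.
move=> Bu Bv a; suff /matrixP/(_ a ord0) : (\col_i v i) = 0 by rewrite !mxE.
rewrite -(mulKmx Bu (\col_i v i)) (_ : B *m _ = 0) ?mulmx0//.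
apply/matrixP => b k; rewrite !mxE -[RHS](Bv b).
by apply: eq_bigr => i _; rewrite mxE.
Qed.

Let PsX l i w := Psi l (X w) i ord0.

Let PsXE l i : PsX i = fun w => \sum_b W l i b * @pX l b w.
Proof.
by apply/funext => w; rewrite /PsX /Psi /orthonormal_vec mxE;
  apply: eq_bigr => b _; rewrite mxE.
Qed.

Lemma polyfun_orthonormal l i : polyfun (fun x => Psi l x i ord0).
Proof.
rewrite (_ : (fun x => _) = fun x => \sum_b W l i b * p (@idx l b) x).
  by apply: polyfun_sum => b; apply: polyfunZ; exact: polyfun_orthopoly.
apply/funext => x; rewrite /Psi /orthonormal_vec mxE.
by apply: eq_bigr => b _; rewrite mxE.
Qed.

Lemma Lfun2_orthonormal l (i : 'I_(nmonom N l)) : PsX i \in L2.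
Proof. exact: (Lfun2_polyfun (polyfun_orthonormal i)). Qed.

Lemma inner_orthopoly0 r l a b : (r < l)%N ->
  inner P (@pX r a) (@pX l b) = 0.
Proof.
move=> rl; have [s [c []]] := orthopoly_deg hp (@idx r a).
have [-> _ _] := hidx r; move=> sr pE.
have -> : @pX r a = fun w => \sum_(j <- s) c j * mX j w.
  by apply/funext => w; rewrite /pX /= pE.
rewrite inner_suml// big_seq big1// => j /(allP sr) jr.
by rewrite inner_lower_monom ?mulr0// (leq_ltn_trans jr rl).
Qed.

Lemma inner_orthonormal_neq r l (i : 'I_(nmonom N r)) (j : 'I_(nmonom N l)) :
  r != l -> inner P (PsX i) (PsX j) = 0.
Proof.
move=> rl; rewrite !PsXE inner_suml//; last by rewrite -PsXE Lfun2_orthonormal.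
rewrite big1// => a _; rewrite inner_sumr// big1 ?mulr0// => b _.
case: (ltngtP r l) rl => // [rl|lr] _; first by rewrite inner_orthopoly0 ?mulr0.
by rewrite innerC inner_orthopoly0 ?mulr0.
Qed.

(** With [G] the moment matrix, [W G W^T W = W] by the whitening equation, and
    [W] can be cancelled on the right. *)
Lemma inner_orthonormal l (i j : 'I_(nmonom N l)) :
  inner P (PsX i) (PsX j) = (i == j)%:R.
Proof.
have Wu := whitening_unit hW l; have Gu := moment_matrix_unit l.
have WGW : W l *m moment_matrix P X idx p l *m (W l)^T = 1%:M.
  apply: (can_inj (mulmxK Wu)).
  by rewrite /= -!mulmxA (whiteningE hW) mulmxV// mul1mx mulmx1.
have -> : (i == j)%:R = (1%:M : 'M[R]_(nmonom N l)) i j by rewrite mxE.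
rewrite -WGW mxE !PsXE inner_sumr//; last first.
  by apply: Lfun2_sum => b; exact: Lfun2Z.
apply: eq_bigr => b _; rewrite inner_suml// mxE mulrC [in RHS]mxE.
congr (_ * _).
by apply: eq_bigr => a _; rewrite moment_matrixE.
Qed.

(** By induction on the degree: the lower monomials are already known to be
    orthogonal to [u], so the leading matrix annihilates the vector of the inner
    products of [u] with the monomials of the current degree. *)
Lemma orthogonal_monoms m u : u \in L2 ->
    (forall l (i : 'I_(nmonom N l)), (l <= m)%N -> inner P u (PsX i) = 0) ->
  forall k, (mabs k <= m)%N -> inner P u (mX k) = 0.
Proof.
move=> u2 uPsi k; have [n] := ubnP (mabs k); elim: n k => // n IH k kn km.
have [_ /(_ k erefl)[a <-] _] := hidx (mabs k).
have [B Bu BE] := leading_matrix (mabs k).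
have lower j : (mabs j < mabs k)%N -> inner P u (mX j) = 0.
  by move=> jk; apply: IH; [exact: leq_trans jk _|exact: ltnW (leq_trans jk _)].
apply: (unitmx_cV_eq0 Bu (v := fun a => inner P u (mX (@idx (mabs k) a)))) => b.
rewrite -BE//.
apply: (unitmx_cV_eq0 (whitening_unit hW _)
  (v := fun b => inner P u (@pX (mabs k) b))) => i.
by rewrite -inner_sumr// -PsXE uPsi.
Qed.

Variable y : 'rV[R]_N -> R.
Hypothesis hy2 : y \o X \in L2.
Let C := pce_coef P X y Psi.
Let y_ := pce_approx P X y Psi.

Lemma pce_coefE l i : C l i ord0 = inner P (y \o X) (PsX i).
Proof.
rewrite mxE unlock; congr fine; apply: eq_integral => w _.
by rewrite mxE.
Qed.

Lemma pce_termE l :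
  pce_term P X y Psi l = fun w => \sum_i C l i ord0 * PsX i w.
Proof.
apply/funext => w; rewrite /pce_term mxE; apply: eq_bigr => i _.
by rewrite mxE.
Qed.

Lemma Lfun2_pce_term l : pce_term P X y Psi l \in L2.
Proof.
rewrite pce_termE; apply: Lfun2_sum => i; apply: Lfun2Z.
exact: Lfun2_orthonormal.
Qed.

Lemma Lfun2_pce_approx m : y_ m \in L2.
Proof. by apply: Lfun2_sum => l; exact: Lfun2_pce_term. Qed.

Lemma inner_pce_approx m u : u \in L2 ->
  inner P u (y_ m) = \sum_(r < m.+1) \sum_i C r i ord0 * inner P u (@PsX r i).
Proof.
move=> u2; have -> : y_ m = fun w => \sum_(r < m.+1) 1 * pce_term P X y Psi r w.
  by apply/funext => w; apply: eq_bigr => r _; rewrite mul1r.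
rewrite inner_sumr//; last by move=> r; exact: Lfun2_pce_term.
apply: eq_bigr => r _; rewrite mul1r pce_termE inner_sumr// => i.
exact: Lfun2_orthonormal.
Qed.

Lemma pce_residual_orthogonal m l (i : 'I_(nmonom N l)) : (l <= m)%N ->
  inner P (fun w => y (X w) - y_ m w) (PsX i) = 0.
Proof.
move=> lm; have i2 := Lfun2_orthonormal i.
rewrite innerC innerBr//; last exact: Lfun2_pce_approx.
have lm1 : (l < m.+1)%N by [].
rewrite inner_pce_approx// (bigD1 (Ordinal lm1))//=.
rewrite [X in _ - (_ + X)]big1 ?addr0 => [|r rl]; last first.
  rewrite big1// => j _; rewrite inner_orthonormal_neq ?mulr0//.
  by apply: contra rl => /eqP lr; apply/eqP/val_inj.
rewrite (bigD1 i)//= inner_orthonormal eqxx mulr1 big1 ?addr0.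
  by rewrite pce_coefE innerC subrr.
by move=> j ji; rewrite inner_orthonormal eq_sym (negbTE ji) mulr0.
Qed.

(** The residual is orthogonal to all polynomials of degree at most [m] and to
    the partial sum, hence to their differences: the theorem of Pythagoras
    applies. *)
Lemma pce_best_approximation m (s : seq (R * mindex N)) :
    all (fun t => mabs t.2 <= m)%N s ->
  (\int[P]_w ((y_ m w - y (X w)) ^+ 2)%:E <=
   \int[P]_w ((y (X w) - \sum_(t <- s) t.1 * monom t.2 (X w)) ^+ 2)%:E)%E.
Proof.
move=> sm; pose u w := y (X w) - y_ m w.
pose q w := \sum_(t <- s) t.1 * mX t.2 w.
have ym2 := Lfun2_pce_approx m.
have u2 : u \in L2 by exact: Lfun2B.
have q2 : q \in L2 by apply: Lfun2_sum => t; exact: Lfun2Z.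
have uPsi := @pce_residual_orthogonal m.
have uq : inner P u q = 0.
  rewrite inner_sumr// big_seq big1// => t /(allP sm) tm.
  by rewrite (orthogonal_monoms u2 uPsi)// mulr0.
have uy : inner P u (y_ m) = 0.
  rewrite inner_pce_approx// big1// => r _.
  by rewrite big1// => j _; rewrite uPsi ?mulr0// -ltnS.
have uyq : inner P u (fun w => y_ m w - q w) = 0.
  by rewrite innerBr// uq uy subrr.
have := pythagoras_le u2 (Lfun2B ym2 q2) uyq.
congr (_ <= _)%E; apply: eq_integral => w _; congr (_%:E).
  by rewrite /u -sqrrN opprB.
by rewrite /u addrA subrK.
Qed.

End expansion.

(** * Modes of convergence *)

Lemma ge0_ecvg0P (R : realType) (a : nat -> \bar R) :
  (forall n, (0 <= a n)%E) ->
  (a n @[n --> \oo] --> 0%E) <->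
  (forall e : R, 0 < e -> \forall n \near \oo, (a n < e%:E)%E).
Proof.
move=> a0; split=> [/fine_cvgP[fa /cvgr_lt a_lt] e e0|ae].
  apply: filterS2 fa (a_lt e e0) => n fan.
  by rewrite /= -lte_fin fineK.
apply/fine_cvgP; split.
  apply: filterS (ae 1 ltr01) => n an1.
  by rewrite ge0_fin_numE// (lt_trans an1)// ltry.
apply/cvgr0Pnorm_lt => e e0; apply: filterS (ae e e0) => n ane.
rewrite /= ger0_norm ?fine_ge0// -lte_fin fineK//.
by rewrite ge0_fin_numE// (lt_trans ane)// ltry.
Qed.

Section convergence_modes.
Context d (T : measurableType d) (R : realType) (P : probability T R).
Variables (Z_ : nat -> T -> R) (Y : T -> R).
Hypothesis mZ : forall n, measurable_fun setT (Z_ n).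
Hypothesis mY : measurable_fun setT Y.

Let mD n : measurable_fun setT (fun w => `|Z_ n w - Y w|).
Proof. by apply: measurableT_comp => //; exact: measurable_funB. Qed.

Let m_gt n (e : R) : measurable [set w | e < `|Z_ n w - Y w|].
Proof.
rewrite (_ : mkset _ = (fun w => `|Z_ n w - Y w|) @^-1` `]e, +oo[%classic).
  by rewrite -[X in measurable X]setTI; apply: mD.
by apply/seteqP; split => w /=; rewrite in_itv /= andbT.
Qed.

Let m_le (U : T -> R) z :
  measurable_fun setT U -> measurable [set w | U w <= z].
Proof.
move=> mU; rewrite (_ : mkset _ = U @^-1` `]-oo, z]%classic).
  by rewrite -[X in measurable X]setTI; apply: mU.
by apply/seteqP; split => w /=; rewrite in_itv.
Qed.

Lemma markov_square n (e : R) : 0 < e ->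
  ((e ^+ 2)%:E * P [set w | (e < `|Z_ n w - Y w|)%R]
    <= \int[P]_w ((Z_ n w - Y w) ^+ 2)%:E)%E.
Proof.
move=> e0; rewrite -[X in P X]setIT -integral_indic//.
rewrite -ge0_integralZl//; last 2 first.
- by apply/measurable_EFinP.
- by rewrite lee_fin sqr_ge0.
apply: ge0_le_integral => //.
- by move=> w _; rewrite mule_ge0// lee_fin ?sqr_ge0.
- by apply: emeasurable_funM => //; apply/measurable_EFinP.
- by apply: measurable_sqr_EFin; exact: measurable_funB.
move=> w _; rewrite indicE -EFinM lee_fin.
case: (boolP (w \in _)) => [/set_mem /= ew|_]; last by rewrite mulr0 sqr_ge0.
rewrite mulr1 -(ger0_norm (sqr_ge0 (Z_ n w - Y w))) normrX.
by rewrite lerXn2r ?nnegrE ?normr_ge0 ?(ltW e0) ?(ltW ew).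
Qed.

Lemma cvg_in_probability :
    (\int[P]_w ((Z_ n w - Y w) ^+ 2)%:E @[n --> \oo] --> 0)%E ->
  forall e : R, 0 < e -> P [set w | e < `|Z_ n w - Y w|] @[n --> \oo] --> 0%E.
Proof.
have sq0 n : (0 <= \int[P]_w ((Z_ n w - Y w) ^+ 2)%:E)%E.
  by apply: integral_ge0 => w _; rewrite lee_fin sqr_ge0.
move=> /(ge0_ecvg0P sq0) sq e e0; apply/ge0_ecvg0P => // k k0.
have e2 : 0 < e ^+ 2 by rewrite exprn_gt0.
apply: filterS (sq _ (mulr_gt0 e2 k0)) => n.
move=> /(le_lt_trans (markov_square n e0)).
by rewrite [X in (_ < X)%E]EFinM lte_pmul2l// lte_fin.
Qed.

(** Unless [Z_ n] and [Y] are more than [e] apart, [Z_ n <= xi] implies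
    [Y <= xi + e] and [Y <= xi - e] implies [Z_ n <= xi]. *)
Lemma distribution_function_shift n (xi e : R) :
  distribution_function P (Z_ n) xi <=
    distribution_function P Y (xi + e) +
      fine (P [set w | e < `|Z_ n w - Y w|]) /\
  distribution_function P Y (xi - e) <=
    distribution_function P (Z_ n) xi +
      fine (P [set w | e < `|Z_ n w - Y w|]).
Proof.
have fine_subU (B C D : set T) : measurable B -> measurable C -> measurable D ->
    B `<=` C `|` D -> fine (P B) <= fine (P C) + fine (P D).
  move=> mB mC mE BCD; rewrite -fineD ?fin_num_measure// fine_le//.
  - exact: fin_num_measure.
  - by rewrite fin_numD !fin_num_measure.
  apply: (le_trans _ (measureU2 P mC mE)).
  by apply: le_measure => //; rewrite inE//; exact: measurableU.
split; apply: fine_subU => //; try exact: m_le; move=> w /= wle.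
- have [|] := leP `|Z_ n w - Y w| e; last by right.
  by rewrite ler_norml => /andP[? ?]; left; lra.
- have [|] := leP `|Z_ n w - Y w| e; last by right.
  by rewrite ler_norml => /andP[? ?]; left; lra.
Qed.

Lemma cvg_in_distribution :
    (forall e : R, 0 < e ->
      P [set w | e < `|Z_ n w - Y w|] @[n --> \oo] --> 0%E) ->
  forall xi : R, {for xi, continuous (distribution_function P Y)} ->
    distribution_function P (Z_ n) xi @[n --> \oo] -->
      distribution_function P Y xi.
Proof.
set F := distribution_function P; move=> inP xi /cvgrPdist_lt cY.
apply/cvgrPdist_lt => e e0.
have e2 : 0 < e / 2 by rewrite divr_gt0.
have [/= k k0 kY] := (nbhs_normP _ _).1 (cY _ e2).
have k2 : 0 < k / 2 by rewrite divr_gt0.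
have Yk z : `|xi - z| <= k / 2 -> `|F Y xi - F Y z| < e / 2.
  by move=> xz; apply: kY => /=; rewrite (le_lt_trans xz)//; lra.
have Yr : `|F Y xi - F Y (xi + k / 2)| < e / 2.
  by apply: Yk; rewrite opprD addrA subrr add0r normrN gtr0_norm.
have Yl : `|F Y xi - F Y (xi - k / 2)| < e / 2.
  by apply: Yk; rewrite opprB addrCA subrr addr0 gtr0_norm.
have P0 n : (0 <= P [set w | (k / 2 < `|Z_ n w - Y w|)%R])%E by [].
have /(ge0_ecvg0P P0)/(_ _ e2) := inP _ k2; apply: filterS => n Pn.
have := distribution_function_shift n xi (k / 2); rewrite -/F.
have : fine (P [set w | k / 2 < `|Z_ n w - Y w|]) < e / 2.
  by rewrite -lte_fin fineK// fin_num_measure.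
move: Yl Yr; rewrite !ltr_norml => /andP[? ?] /andP[? ?] ? [? ?].
by apply/andP; split; lra.
Qed.

End convergence_modes.

(** * The generalized polynomial chaos expansion *)

(** A polynomial close to [y(X)] has some degree, and all later partial sums are
    at least as close. *)
Lemma pce_mean_square (R : realType) (d : measure_display)
    (T : measurableType d) (P : probability T R) (N : nat) (A : set 'rV[R]_N)
    (X : {RV P >-> 'rV[R]_N}) (f nrm : 'rV[R]_N -> R) (le : rel (mindex N))
    (idx : forall l : nat, 'I_(nmonom N l) -> mindex N)
    (p : mindex N -> 'rV[R]_N -> R) (W : forall l : nat, 'M[R]_(nmonom N l))
    (y : 'rV[R]_N -> R) :
    is_norm nrm -> input_assumption A X f nrm -> monomial_listing le idx ->
    orthogonal_polynomials A f idx p -> whitening P X idx p W ->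
    measurable_fun A y -> ('E_P[fun w => (y (X w) ^+ 2)%R] < +oo)%E ->
  (\int[P]_w
      ((pce_approx P X y (orthonormal_vec idx p W) m w - y (X w)) ^+ 2)%:E
    @[m --> \oo] --> 0)%E.
Proof.
move=> hnrm hX hidx hp hW hy hy2.
have Y2 : y \o X \in Lfun P 2%:E.
  apply/Lfun2P; split; first exact: (measurable_fun_input hX).
  by move: hy2; rewrite unlock.
apply/ge0_ecvg0P => [m|e e0].
  by apply: integral_ge0 => w _; rewrite lee_fin sqr_ge0.
have [_ [s ->] qe] := polyfun_dense_input hX hnrm hy hy2 e0.
exists (\max_(t <- s) mabs t.2)%N => // m /= sm.
apply: le_lt_trans qe; rewrite unlock.
apply: (pce_best_approximation hX hidx hp hW Y2).
apply/allP => t ts; apply: leq_trans sm.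
by rewrite (big_rem t)//= leq_maxl.
Qed.

Theorem theorem11
  (R : realType) (d : measure_display) (T : measurableType d)
  (P : probability T R) (hP : measure_is_complete P)
  (N : nat) (hN : (0 < N)%N)
  (A : set 'rV[R]_N) (X : {RV P >-> 'rV[R]_N}) (f nrm : 'rV[R]_N -> R)
  (hnrm : is_norm nrm) (hX : input_assumption A X f nrm)
  (le : rel (mindex N)) (hle : monomial_order le)
  (idx : forall l : nat, 'I_(nmonom N l) -> mindex N)
  (hidx : monomial_listing le idx)
  (p : mindex N -> 'rV[R]_N -> R) (hp : orthogonal_polynomials A f idx p)
  (W : forall l : nat, 'M[R]_(nmonom N l)) (hW : whitening P X idx p W)
  (y : 'rV[R]_N -> R) (hy : measurable_fun A y)
  (hy2 : ('E_P[fun w => (y (X w) ^+ 2)%R] < +oo)%E) :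
  let Psi := orthonormal_vec idx p W in
  let C := pce_coef P X y Psi in
  let y_ := pce_approx P X y Psi in
  (* (1) *)
  [/\ forall (l : nat) (i : 'I_(nmonom N l)),
        P.-integrable setT (fun w => (y (X w) * Psi l (X w) i ord0)%:E) /\
        (lebesgue_rV R N).-integrable A
          (fun x => (y x * Psi l x i ord0 * f x)%:E),
      forall l : nat, C l = mx_integral A f (fun x => y x *: Psi l x) &
      L2_series_sum P (pce_term P X y Psi) (fun w => y (X w))] /\
  (* (2) *)
  [/\ 'E_P[fun w => (`|y_ m w - y (X w)| ^+ 2)%R]%E @[m --> \oo] --> 0%E,
      forall eps : R, 0 < eps ->
        P [set w | eps < `|y_ m w - y (X w)|] @[m --> \oo] --> 0%E &
      forall xi : R,
        {for xi, continuous (distribution_function P (fun w => y (X w)))} ->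
        distribution_function P (y_ m) xi @[m --> \oo]
          --> distribution_function P (fun w => y (X w)) xi].
Proof.
move=> Psi C y_.
have mY : measurable_fun setT (y \o X) by exact: (measurable_fun_input hX).
have Y2 : y \o X \in Lfun P 2%:E.
  by apply/Lfun2P; split => //; move: hy2; rewrite unlock.
have sq_cvg := pce_mean_square hnrm hX hidx hp hW hy hy2.
have y_2 m : y_ m \in Lfun P 2%:E by exact: (Lfun2_pce_approx W hX hp y).
have my_ m := Lfun2_measurable (y_2 m).
have PsiX2 l (i : 'I_(nmonom N l)) := Lfun2_orthonormal W hX hp i.
have mPsi l i : measurable_fun A (fun x => Psi l x i ord0).
  apply: measurable_funTS; apply: measurable_polyfun.
  exact: (polyfun_orthonormal W hp i).
have yPsi l i := @integral_input _ _ _ _ _ _ _ _ _ hX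
  (fun x => y x * Psi l x i ord0) (measurable_funM hy (mPsi l i))
  (Lfun2_integrableM Y2 (PsiX2 l i)).
split; split.
- by move=> l i; split; [exact: Lfun2_integrableM|have [] := yPsi l i].
- move=> l; apply/matrixP => i k; rewrite !mxE (ord1 k).
  have [_] := yPsi l i; rewrite unlock => yE.
  transitivity (fine (\int[P]_w (y (X w) * Psi l (X w) i ord0)%:E)%E).
    by congr fine; apply: eq_integral => w _; rewrite mxE.
  by rewrite yE; apply: eq_Rintegral => x _; rewrite [in RHS]mxE.
- split => //; first by move=> l; exact: (Lfun2_pce_term W hX hp y).
  rewrite -cvg_shiftS; apply/ge0_ecvg0P => [m|e e0]; first exact: Lnorm_ge0.
  have sq0 m : (0 <= \int[P]_w ((y_ m w - y (X w)) ^+ 2)%:E)%E.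
    by apply: integral_ge0 => w _; rewrite lee_fin sqr_ge0.
  have e2 : 0 < e ^+ 2 by rewrite exprn_gt0.
  have /(ge0_ecvg0P sq0)/(_ _ e2) := sq_cvg; apply: filterS => m lt_e2.
  (* the norm is a square root: compare squares *)
  rewrite ltNge; apply/negP => /(gt0_ler_poweR (ltW (ltr0n R 2))).
  rewrite !in_itv /= !leey !andbT lee_fin (ltW e0) Lnorm_ge0 => /(_ isT isT).
  rewrite leNgt powR_Lnorm ?pnatr_eq0// => /negP; apply.
  rewrite powR_mulrn ?ltW//; move: lt_e2; congr (_ < _)%E.
  apply: eq_integral => w _ /=; rewrite powR_mulrn//.
  by rewrite -normrX ger0_norm// sqr_ge0.
- move: sq_cvg; rewrite unlock; under [X in _ -> X]eq_cvg => m.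
    under eq_integral => w _ do rewrite -normrX ger0_norm ?sqr_ge0//.
    over.
  by [].
- move=> eps eps0; exact: cvg_in_probability.
- apply: cvg_in_distribution => // eps eps0; exact: cvg_in_probability.
Qed.
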